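(* Let $\mathfrak{h}$ be a real $3$-step nilpotent Lie algebra whose center $\mathrm{Z}(\mathfrak{h})$ satisfies $\dim \mathrm{Z}(\mathfrak{h})=1$. Let $\langle\;,\;\rangle$ be a Lorentzian inner product on $\mathfrak{h}$ such that $\mathrm{Z}(\mathfrak{h})$ is non-degenerate. Then $(\mathfrak{h},\langle\;,\;\rangle)$ is Einstein if and only if it is Ricci-flat and one of the following holds: (i) $\dim\mathfrak{h}=6$ and there exist a basis $(f_1,\dots,f_6)$ of $\mathfrak{h}$ and a real number $\alpha\neq 0$ such that the only non-vanishing Lie brackets of basis vectors (up to antisymmetry) are $[f_1,f_2]=f_4,\ [f_1,f_3]=f_5,\ [f_2,f_4]=f_6,\ [f_3,f_5]=-f_6$ (so $\mathfrak{h}$ is isomorphic to the Lie algebra $\mathrm{L}_{6,19}(-1)$), and the metric is $\langle\;,\;\rangle=f_1^*\otimes f_1^*+2f_2^*\otimes f_2^*+2f_3^*\otimes f_3^*+4\alpha^4f_6^*\otimes f_6^*-2\alpha^2 f_4^*\odot f_5^*$; (ii) $\dim\mathfrak{h}=7$ and there exist a basis $(f_1,\dots,f_7)$ of $\mathfrak{h}$ and real numbers $0<r<1$, $a>0$ such that the only non-vanishing Lie brackets of basis vectors (up to antisymmetry) are $[f_1,f_2]=f_5,\ [f_1,f_3]=f_6,\ [f_2,f_3]=f_4,\ [f_6,f_2]=(1-r)f_7,\ [f_5,f_3]=-rf_7,\ [f_4,f_1]=f_7,$ and the metric is $\langle\;,\;\rangle=f_1^*\otimes f_1^*+f_2^*\otimes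 f_2^*+f_3^*\otimes f_3^*-a f_4^*\otimes f_4^*+ar f_5^*\otimes f_5^*+a(1-r)f_6^*\otimes f_6^*+a^2 f_7^*\otimes f_7^*$.
   Context: A Lorentzian inner product is a nondegenerate symmetric bilinear form of signature $(1,n-1)$ (one negative direction). A subspace is non-degenerate if the restriction of the form to it is nondegenerate. For a Lie algebra with pseudo-Euclidean inner product, the Levi-Civita product $\mathrm{L}$ is defined by $2\langle \mathrm{L}_uv,w\rangle=\langle[u,v],w\rangle+\langle[w,u],v\rangle+\langle[w,v],u\rangle$, the curvature by $K(u,v)=\mathrm{L}_{[u,v]}-[\mathrm{L}_u,\mathrm{L}_v]$, the Ricci curvature by $\mathrm{ric}(u,v)=\mathrm{tr}(w\mapsto K(u,w)v)$ and the Ricci operator $\mathrm{Ric}$ by $\langle\mathrm{Ric}(u),v\rangle=\mathrm{ric}(u,v)$. The metric is Einstein if $\mathrm{Ric}=\lambda\,\mathrm{Id}$ for some constant $\lambda\in\mathbb{R}$, and Ricci-flat if $\mathrm{ric}=0$. $(f_i^* )$ denotes the dual basis of $(f_i)$, and $f_4^*\odot f_5^*=f_4^*\otimes f_5^*+f_5^*\otimes f_4^*$. *)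

(* Defs.v *)
From HB Require Import structures.
From mathcomp Require Import all_boot all_order all_algebra.
From mathcomp Require Import reals.
Set Implicit Arguments. Unset Strict Implicit. Unset Printing Implicit Defensive.
Import Order.TTheory GRing.Theory Num.Theory.
Local Open Scope ring_scope.

Section LieDefs.
Variables (R : realType) (n : nat).
Notation vec := 'rV[R]_n.

Definition is_lie_bracket (br : vec -> vec -> vec) : Prop :=
  [/\ (forall (a : R) (u v w : vec), br (a *: u + v) w = a *: br u w + br v w),
      (forall (a : R) (u v w : vec), br w (a *: u + v) = a *: br w u + br w v),
      (forall u : vec, br u u = 0) &
      (forall x y z : vec, br x (br y z) + br y (br z x) + br z (br x y) = 0)].

(* 3-step nilpotent: C^4 = [h,[h,[h,h]]] = 0 and C^3 = [h,[h,h]] <> 0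
   (the lower central series terms are spanned by left-normed brackets). *)
Definition three_step_nilpotent (br : vec -> vec -> vec) : Prop :=
  (forall x y z w : vec, br x (br y (br z w)) = 0) /\
  (exists x y z : vec, br x (br y z) != 0).

Definition in_center (br : vec -> vec -> vec) (z : vec) : Prop :=
  forall x : vec, br z x = 0.

Definition center_dim1 (br : vec -> vec -> vec) : Prop :=
  exists z0 : vec, z0 != 0 /\
    (forall v : vec, in_center br v <-> exists c : R, v = c *: z0).

Definition ip (G : 'M[R]_n) (u v : vec) : R := (u *m G *m v^T) 0 0.

Definition lorentzian (G : 'M[R]_n) : Prop :=
  G^T = G /\
  exists (P : 'M[R]_n) (i0 : 'I_n), P \in unitmx /\
    P *m G *m P^T =
      \matrix_(i, j) (if i == j then (if i == i0 then -1 else 1) else 0).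

Definition nondegenerate_sub (G : 'M[R]_n) (S : vec -> Prop) : Prop :=
  forall v : vec, S v -> (forall w : vec, S w -> ip G v w = 0) -> v = 0.

Definition ebase (k : 'I_n) : vec := delta_mx 0 k.

(* Levi-Civita product: the unique L_u v with
   2 <L_u v, w> = <[u,v],w> + <[w,u],v> + <[w,v],u>. *)
Definition LC (br : vec -> vec -> vec) (G : 'M[R]_n) (u v : vec) : vec :=
  (2^-1) *: ((\row_k (ip G (br u v) (ebase k) + ip G (br (ebase k) u) v
                       + ip G (br (ebase k) v) u)) *m invmx G).

Definition curv (br : vec -> vec -> vec) (G : 'M[R]_n) (u v w : vec) : vec :=
  LC br G (br u v) w - (LC br G u (LC br G v w) - LC br G v (LC br G u w)).

Definition ric (br : vec -> vec -> vec) (G : 'M[R]_n) (u v : vec) : R :=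
  \sum_(k < n) (curv br G u (ebase k) v) 0 k.

(* Ricci operator: <Ric u, v> = ric(u,v). *)
Definition Ric (br : vec -> vec -> vec) (G : 'M[R]_n) (u : vec) : vec :=
  (\row_k ric br G u (ebase k)) *m invmx G.

Definition einstein (br : vec -> vec -> vec) (G : 'M[R]_n) : Prop :=
  exists lambda : R, forall u : vec, Ric br G u = lambda *: u.

Definition ricci_flat (br : vec -> vec -> vec) (G : 'M[R]_n) : Prop :=
  forall u v : vec, ric br G u v = 0.

(* The bracket and metric have structure constants c (c i j k = coefficient
   of f_k in [f_i, f_j]) and Gram entries g in the basis given by the rows of
   F; indices are 1-based: row i of F is f_(i+1). *)
Definition has_brackets (br : vec -> vec -> vec) (F : 'M[R]_n)
  (c : nat -> nat -> nat -> R) : Prop :=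
  forall i j : 'I_n,
    br (row i F) (row j F) = \sum_(k < n) c i.+1 j.+1 k.+1 *: row k F.

Definition has_metric (G : 'M[R]_n) (F : 'M[R]_n) (g : nat -> nat -> R) : Prop :=
  forall i j : 'I_n, ip G (row i F) (row j F) = g i.+1 j.+1.

End LieDefs.

Definition C6 {R : realType} (i j k : nat) : R :=
  match i, j, k with
  | 1, 2, 4 => 1 | 2, 1, 4 => -1
  | 1, 3, 5 => 1 | 3, 1, 5 => -1
  | 2, 4, 6 => 1 | 4, 2, 6 => -1
  | 3, 5, 6 => -1 | 5, 3, 6 => 1
  | _, _, _ => 0
  end.

Definition G6 {R : realType} (al : R) (i j : nat) : R :=
  match i, j with
  | 1, 1 => 1 | 2, 2 => 2 | 3, 3 => 2
  | 6, 6 => 4 * al ^+ 4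
  | 4, 5 => - (2 * al ^+ 2) | 5, 4 => - (2 * al ^+ 2)
  | _, _ => 0
  end.

Definition C7 {R : realType} (r : R) (i j k : nat) : R :=
  match i, j, k with
  | 1, 2, 5 => 1 | 2, 1, 5 => -1
  | 1, 3, 6 => 1 | 3, 1, 6 => -1
  | 2, 3, 4 => 1 | 3, 2, 4 => -1
  | 6, 2, 7 => 1 - r | 2, 6, 7 => - (1 - r)
  | 5, 3, 7 => - r | 3, 5, 7 => r
  | 4, 1, 7 => 1 | 1, 4, 7 => -1
  | _, _, _ => 0
  end.

Definition G7 {R : realType} (r a : R) (i j : nat) : R :=
  match i, j with
  | 1, 1 => 1 | 2, 2 => 1 | 3, 3 => 1
  | 4, 4 => - a | 5, 5 => a * r | 6, 6 => a * (1 - r)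
  | 7, 7 => a ^+ 2
  | _, _ => 0
  end.

(* Main.v *)
Require Import Defs.
From HB Require Import structures.
From mathcomp Require Import all_boot all_order all_algebra.
From mathcomp Require Import reals.
From mathcomp Require Import complex ring lra.
Import Order.TTheory GRing.Theory Num.Theory.
Local Open Scope ring_scope.

Set Implicit Arguments. Unset Strict Implicit. Unset Printing Implicit Defensive.

(** Writing [R_v] for the map [u |-> L_u v], nilpotency kills all traces of [ad]
and [ric(u,v) = - tr (R_u R_v)], which expands in any orthonormal frame to
[-1/2 sum <[u,f_i],[v,f_i]> + 1/4 sum <[f_i,f_j],u><[f_i,f_j],v>] (with signs).

Let [e] be the normalised central vector and [C = [h,h]], which contains [e];
then [[C,C] = 0] and [[c,x] = <[c,x],e> e] for [c] in [C]. Comparing Ricci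
curvatures successively excludes that [e] is timelike, that [C] is degenerate,
and that [C] is positive definite. Hence [C] is Lorentzian and its orthogonal
complement [V] is Euclidean.

For [v] in [V] let [S v] in [C] be the vector orthogonal to [e] such that
[<S v, c> = <[c,v],e>] for [c] in [C]. By the spectral theorem [V] has an orthonormal basis
[v_a] such that the [y_a = S v_a] are orthogonal, with norms [mu_a], exactly one
of which, [mu_o], is negative. The Einstein equations and the Jacobi identity
become polynomial equations on [t k a b = <[v_a,v_b],y_k>]. Their traces give
[lambda = 0] and leave only the entries [N k b = t k o b]; then
[(N a b - N b a)^2 <= (mu_a + mu_b) (N a b^2 / mu_a + N b a^2 / mu_b)] together
with [mu_a + mu_b <= - mu_o] is forced to be an equality after summing over [b],
which leaves a three-dimensional [V]: the case (ii) if all [mu_a] are nonzero, and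
(i) if one vanishes. *)

(** * Diagonalization of real symmetric matrices *)

Section Spectral.
Variable R : rcfType.

Definition dot n (u v : 'rV[R]_n) : R := (u *m v^T) 0 0.

Lemma dotE n (u v : 'rV[R]_n) : dot u v = \sum_i u 0 i * v 0 i.
Proof. by rewrite /dot mxE; apply: eq_bigr => i _; rewrite mxE. Qed.

Lemma dot_mx n (u v : 'rV[R]_n) : u *m v^T = (dot u v)%:M.
Proof. by rewrite [LHS]mx11_scalar. Qed.

Lemma dot_ge0 n (u : 'rV[R]_n) : 0 <= dot u u.
Proof. by rewrite dotE; apply: sumr_ge0 => i _; rewrite -expr2 sqr_ge0. Qed.

Lemma dot_eq0 n (u : 'rV[R]_n) : (dot u u == 0) = (u == 0).
Proof.
apply/eqP/eqP => [|->]; last by rewrite /dot mul0mx mxE.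
rewrite dotE => /eqP; rewrite psumr_eq0 => [/allP h|i _]; last by rewrite -expr2 sqr_ge0.
apply/rowP => i; have := h i (mem_index_enum _); rewrite mxE /=.
by rewrite mulf_eq0 orbb => /eqP.
Qed.

Lemma dotC n (u v : 'rV[R]_n) : dot u v = dot v u.
Proof. by rewrite !dotE; apply: eq_bigr => i _; rewrite mulrC. Qed.

Lemma dotDl n (u v w : 'rV[R]_n) : dot (u + v) w = dot u w + dot v w.
Proof. by rewrite /dot mulmxDl mxE. Qed.

Lemma dotZl n a (u v : 'rV[R]_n) : dot (a *: u) v = a * dot u v.
Proof. by rewrite /dot -scalemxAl mxE. Qed.

(** A complex eigenvector [x + i y] with eigenvalue [a + i b] exists; comparing [dot (x *m Q) y]
    with [dot x (y *m Q)] gives [b * (dot x x + dot y y) = 0]. Hence [b = 0], and whichever of [x],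
    [y] is nonzero is a real eigenvector. *)
Lemma symmetric_real_eigenvector n (Q : 'M[R]_n.+1) : Q^T = Q ->
  exists (a : R) (u : 'rV[R]_n.+1), u != 0 /\ u *m Q = a *: u.
Proof.
move=> symQ.
pose QC := map_mx (real_complex R) Q.
have [|[a b] /eigenvalueP [v vQ vn0]] := @eigenvalue_closed R[i] n.+1 QC; first by [].
pose x := map_mx (@complex.Re R) v; pose y := map_mx (@complex.Im R) v.
have hx : x *m Q = a *: x - b *: y.
  apply/rowP => i; move/rowP/(_ i)/(congr1 (@complex.Re R)) : vQ.
  rewrite !mxE raddf_sum /= => h.
  transitivity (\sum_j complex.Re (v 0 j * QC j i)).
    by apply: eq_bigr => j _; rewrite !mxE; case: (v 0 j) => p q /=; rewrite mulr0 subr0.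
  by rewrite h; case: (v 0 i).
have hy : y *m Q = b *: x + a *: y.
  apply/rowP => i; move/rowP/(_ i)/(congr1 (@complex.Im R)) : vQ.
  rewrite !mxE raddf_sum /= => h.
  transitivity (\sum_j complex.Im (v 0 j * QC j i)).
    by apply: eq_bigr => j _; rewrite !mxE; case: (v 0 j) => p q /=; rewrite mulr0 add0r.
  by rewrite h; case: (v 0 i) => p q /=; rewrite addrC.
have hs : dot (x *m Q) y = dot x (y *m Q).
  by rewrite /dot trmx_mul symQ mulmxA.
have b0 : b * (dot x x + dot y y) = 0.
  move: hs; rewrite hx hy -scaleNr (dotC x) !dotDl !dotZl (dotC y x); lra.
have xy0 : dot x x + dot y y != 0.
  rewrite paddr_eq0 ?dot_ge0 // !dot_eq0; apply: contra vn0 => /andP[/eqP x0 /eqP y0].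
  apply/eqP/rowP => i; move/rowP/(_ i): x0; move/rowP/(_ i): y0; rewrite !mxE.
  by case: (v 0 i) => p q /= -> ->.
have {}b0 : b = 0 by apply/eqP; move/eqP: b0; rewrite mulf_eq0 (negPf xy0) orbF.
move: hx hy; rewrite b0 !scale0r subr0 add0r => hx hy.
have [x0|xn0] := eqVneq x 0; last by exists a, x.
exists a, y; split => //; apply: contra xy0 => /eqP ->.
by rewrite x0 /dot !mul0mx !mxE addr0.
Qed.

Lemma symmetric_unit_eigenvector n (Q : 'M[R]_n.+1) : Q^T = Q ->
  exists (a : R) (u : 'rV[R]_n.+1), dot u u = 1 /\ u *m Q = a *: u.
Proof.
move=> /symmetric_real_eigenvector [a [u [un0 uQ]]].
have u_gt0 : 0 < dot u u by rewrite lt_def dot_eq0 un0 dot_ge0.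
exists a, ((Num.sqrt (dot u u))^-1 *: u); split; last first.
  by rewrite -scalemxAl uQ !scalerA mulrC.
rewrite dotZl dotC dotZl mulrA -invfM -expr2.
by rewrite sqr_sqrtr ?dot_ge0 // mulVf // gt_eqF.
Qed.

(* Householder reflection exchanging the first basis vector and u. *)
Lemma orthogonal_first_row n (u : 'rV[R]_n.+1) : dot u u = 1 ->
  exists H : 'M[R]_n.+1, H *m H^T = 1%:M /\ delta_mx 0 0 *m H = u.
Proof.
move=> u1; pose e0 : 'rV[R]_n.+1 := delta_mx 0 0.
have [<-|ue] := eqVneq e0 u; first by exists 1%:M; rewrite trmx1 !mulmx1.
pose w := u - e0.
have e1 : dot e0 e0 = 1.
  rewrite dotE (bigD1 0) //= big1 ?addr0 ?mxE ?eqxx ?mulr1 // => i /negPf i0.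
  by rewrite !mxE i0 mul0r.
have ww : dot w w = 2 - 2 * dot u e0.
  have -> : dot w w = dot u u - dot u e0 - dot e0 u + dot e0 e0.
    by rewrite !dotE -!sumrB -big_split; apply: eq_bigr => i _; rewrite !mxE /=; ring.
  by rewrite (dotC e0 u) u1 e1; ring.
have w0 : dot w w != 0 by rewrite dot_eq0 subr_eq0 eq_sym.
pose c := 2 / dot w w.
pose P := w^T *m w.
have PT : P^T = P by rewrite /P trmx_mul trmxK.
have PP : P *m P = dot w w *: P.
  by rewrite /P mulmxA -(mulmxA _ w) dot_mx mul_mx_scalar -scalemxAl.
exists (1%:M - c *: P); split.
  have -> : (1%:M - c *: P)^T = 1%:M - c *: P by rewrite raddfB /= trmx1 linearZ /= PT.
  rewrite mulmxBl mulmxBr mulmx1 mul1mx -scalemxAl mulmxBr mulmx1 -scalemxAr PP.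
  apply/matrixP => i j; rewrite !mxE /c; field.
  by rewrite w0.
rewrite mulmxBr mulmx1 -scalemxAr mulmxA dot_mx mul_scalar_mx scalerA.
(* Since [dot w w = - 2 * dot e0 w], the reflection sends [e0] to [e0 + w = u]. *)
have -> : c * dot e0 w = -1.
  have -> : dot e0 w = dot u e0 - dot e0 e0.
    by rewrite !dotE -!sumrB; apply: eq_bigr => i _; rewrite !mxE /=; ring.
  by rewrite /c e1; apply: (mulIf w0); rewrite mulrAC divfK // ww; ring.
by rewrite scaleN1r opprK /w addrC subrK.
Qed.

(** Induction on the size: conjugating by an orthogonal matrix whose first row is a unit eigenvector
    clears the first row, and by symmetry the first column; the remaining block is handled by
    induction. *)
Theorem symmetric_diagonalization n (Q : 'M[R]_n) : Q^T = Q ->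
  exists (O : 'M[R]_n) (d : 'rV[R]_n), O *m O^T = 1%:M /\ O *m Q *m O^T = diag_mx d.
Proof.
elim: n Q => [|n IHn] Q symQ.
  by exists 1%:M, 0; split; apply/matrixP => -[].
have [a [u [u1 uQ]]] := symmetric_unit_eigenvector symQ.
have [H [HH Hu]] := orthogonal_first_row u1.
pose Q1 : 'M[R]_(1 + n) := H *m Q *m H^T.
have symQ1 : Q1^T = Q1 by rewrite /Q1 !trmx_mul trmxK symQ mulmxA.
have HH' : H^T *m H = 1%:M by apply: mulmx1C.
have row1 : (delta_mx 0 0 : 'rV_(1 + n)) *m Q1 = a *: delta_mx 0 0.
  by rewrite /Q1 !mulmxA Hu uQ -scalemxAl -Hu -mulmxA HH mulmx1.
have ul : ulsubmx Q1 = a%:M.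
  apply/matrixP => i j; rewrite !ord1 !mxE lshift0.
  by move/rowP/(_ 0): row1; rewrite -rowE !mxE /= => ->; rewrite mulr1.
have ur : ursubmx Q1 = 0.
  apply/matrixP => i j; rewrite !ord1 !mxE lshift0.
  by move/rowP/(_ (rshift 1 j)): row1; rewrite -rowE !mxE /= => ->; rewrite mulr0.
have dl : dlsubmx Q1 = 0 by rewrite -symQ1 -trmx_ursub ur trmx0.
have [|O' [d' [OO Od]]] := IHn (drsubmx Q1); first by rewrite trmx_drsub symQ1.
pose B : 'M[R]_(1 + n) := block_mx 1%:M 0 0 O'.
have BT : B^T = block_mx 1%:M 0 0 O'^T by rewrite /B tr_block_mx !trmx0 trmx1.
have BB : B *m B^T = 1%:M.
  rewrite BT mulmx_block !(mul0mx, mulmx0, addr0, add0r) OO mulmx1.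
  by rewrite -scalar_mx_block.
have BQ : B *m Q1 *m B^T = diag_mx (row_mx a%:M d').
  rewrite BT -[Q1]submxK ul ur dl !mulmx_block.
  rewrite !(mul0mx, mulmx0, addr0, add0r, mulmx1, mul1mx) Od.
  by rewrite diag_mx_row; congr block_mx; apply/matrixP => i j; rewrite !ord1 !mxE.
exists (B *m H), (row_mx a%:M d'); split.
  by rewrite trmx_mul !mulmxA -(mulmxA B) HH mulmx1.
by rewrite -BQ /Q1 trmx_mul !mulmxA.
Qed.

End Spectral.

(** * Ricci curvature of a nilpotent Lie algebra *)

(** Induction on the exponent, with varying size. A rank factorisation [A = C D] gives
    [tr A = tr (D C)], and [C (D C)^k D = A^(k+1) = 0]; cancelling the full-rank factors leaves
    [(D C)^k = 0]. *)
Lemma mxtrace_nilpotent (F : fieldType) n (A : 'M[F]_n) k :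
  (iter k (mulmx A) 1%:M) = 0 -> \tr A = 0.
Proof.
elim: k n A => [|k IHk] n A /=.
  by move=> n0; rewrite -[A]mul1mx n0 mul0mx mxtrace0.
move=> Ak; have := mulmx_base A; have := row_base_free A; have := col_base_full A.
move: (col_base A) (row_base A) => C D Cfull Dfree AE.
rewrite -AE mxtrace_mulC; apply: IHk; set B := D *m C.
have it j : iter j (mulmx A) 1%:M *m C = C *m iter j (mulmx B) 1%:M.
  elim: j => [|j IHj] /=; first by rewrite mul1mx mulmx1.
  by rewrite -mulmxA IHj !mulmxA AE.
have comm j : iter j (mulmx A) 1%:M *m A = A *m iter j (mulmx A) 1%:M.
  by elim: j => [|j IHj] /=; rewrite ?mul1mx ?mulmx1 // -mulmxA IHj.
apply: (row_free_inj Dfree); rewrite mul0mx.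
apply: (row_full_inj Cfull).
by rewrite mulmx0 mulmxA -it -mulmxA AE comm.
Qed.

(** * Linearity of the inner product and of the bracket *)

Section Form.
Variables (R : realType) (n : nat) (G : 'M[R]_n).
Local Notation vec := 'rV[R]_n.

Lemma ipDl (u v w : vec) : ip G (u + v) w = ip G u w + ip G v w.
Proof. by rewrite /ip !mulmxDl mxE. Qed.
Lemma ipZl a (u w : vec) : ip G (a *: u) w = a * ip G u w.
Proof. by rewrite /ip -!scalemxAl mxE. Qed.
Lemma ipDr (u v w : vec) : ip G w (u + v) = ip G w u + ip G w v.
Proof. by rewrite /ip linearD mulmxDr mxE. Qed.
Lemma ipZr a (u w : vec) : ip G w (a *: u) = a * ip G w u.
Proof. by rewrite /ip linearZ -scalemxAr mxE. Qed.
Lemma ip0l (w : vec) : ip G 0 w = 0.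
Proof. by rewrite -(scale0r 0) ipZl mul0r. Qed.
Lemma ip0r (w : vec) : ip G w 0 = 0.
Proof. by rewrite -(scale0r 0) ipZr mul0r. Qed.
Lemma ipNl (u w : vec) : ip G (- u) w = - ip G u w.
Proof. by rewrite -scaleN1r ipZl mulN1r. Qed.
Lemma ipNr (u w : vec) : ip G w (- u) = - ip G w u.
Proof. by rewrite -scaleN1r ipZr mulN1r. Qed.
Lemma ipBl (u v w : vec) : ip G (u - v) w = ip G u w - ip G v w.
Proof. by rewrite ipDl ipNl. Qed.
Lemma ipBr (u v w : vec) : ip G w (u - v) = ip G w u - ip G w v.
Proof. by rewrite ipDr ipNr. Qed.
Lemma ip_suml (I : finType) (F : I -> vec) w :
  ip G (\sum_i F i) w = \sum_i ip G (F i) w.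
Proof. by apply: (big_morph (ip G ^~ w)) => [u v|]; rewrite ?ipDl ?ip0l. Qed.
Lemma ip_sumr (I : finType) (F : I -> vec) w :
  ip G w (\sum_i F i) = \sum_i ip G w (F i).
Proof. by apply: (big_morph (ip G w)) => [u v|]; rewrite ?ipDr ?ip0r. Qed.
Lemma ip_mx (u v : vec) : u *m G *m v^T = (ip G u v)%:M.
Proof. by rewrite [LHS]mx11_scalar. Qed.
Lemma ip_ebase (u : vec) k : ip G u (ebase R k) = (u *m G) 0 k.
Proof. by rewrite /ip /ebase trmx_delta -colE mxE. Qed.

Hypothesis symG : G^T = G.
Lemma ipC (u v : vec) : ip G u v = ip G v u.
Proof.
have : (u *m G *m v^T)^T = v *m G *m u^T by rewrite !trmx_mul trmxK symG mulmxA.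
by move/matrixP/(_ 0 0); rewrite mxE.
Qed.
End Form.

Section Bracket.
Variables (R : realType) (n : nat) (br : 'rV[R]_n -> 'rV[R]_n -> 'rV[R]_n).
Local Notation vec := 'rV[R]_n.
Hypothesis lie : is_lie_bracket br.

Lemma brPl a u v w : br (a *: u + v) w = a *: br u w + br v w.
Proof. by case: lie. Qed.
Lemma brPr a u v w : br w (a *: u + v) = a *: br w u + br w v.
Proof. by case: lie. Qed.
Lemma br_self u : br u u = 0. Proof. by case: lie. Qed.
Lemma brDl u v w : br (u + v) w = br u w + br v w.
Proof. by rewrite -[u]scale1r brPl !scale1r. Qed.
Lemma brDr u v w : br w (u + v) = br w u + br w v.
Proof. by rewrite -[u]scale1r brPr !scale1r. Qed.
Lemma br0l w : br 0 w = 0.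
Proof. by have := brDl 0 0 w; rewrite addr0 -{1}[br 0 w]addr0 => /addrI. Qed.
Lemma br0r w : br w 0 = 0.
Proof. by have := brDr 0 0 w; rewrite addr0 -{1}[br w 0]addr0 => /addrI. Qed.
Lemma brZl a u w : br (a *: u) w = a *: br u w.
Proof. by rewrite -[a *: u]addr0 brPl br0l addr0. Qed.
Lemma brZr a u w : br w (a *: u) = a *: br w u.
Proof. by rewrite -[a *: u]addr0 brPr br0r addr0. Qed.
Lemma brNl u w : br (- u) w = - br u w.
Proof. by rewrite -scaleN1r brZl scaleN1r. Qed.
Lemma brNr u w : br w (- u) = - br w u.
Proof. by rewrite -scaleN1r brZr scaleN1r. Qed.
Lemma br_suml (I : finType) (F : I -> vec) w : br (\sum_i F i) w = \sum_i br (F i) w.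
Proof. by apply: (big_morph (br ^~ w)) => [u v|]; rewrite ?brDl ?br0l. Qed.
Lemma br_sumr (I : finType) (F : I -> vec) w : br w (\sum_i F i) = \sum_i br w (F i).
Proof. by apply: (big_morph (br w)) => [u v|]; rewrite ?brDr ?br0r. Qed.
Lemma brC u v : br u v = - br v u.
Proof.
apply/eqP; rewrite -addr_eq0; apply/eqP.
by have := br_self (u + v); rewrite brDl !brDr !br_self add0r addr0.
Qed.
Lemma jacobi x y z : br x (br y z) + br y (br z x) + br z (br x y) = 0.
Proof. by case: lie. Qed.

(** Vectors are rows, so matrices act on the right and products of these matrices compose in reverse
    order. *)
Definition ad (u : vec) : 'M[R]_n := \matrix_(i, j) br u (ebase R i) 0 j.

Lemma adE u w : br u w = w *m ad u.
Proof.
rewrite {1}[w]row_sum_delta br_sumr; apply/rowP => j; rewrite summxE mxE.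
by apply: eq_bigr => i _; rewrite brZr !mxE.
Qed.
End Bracket.

(** * The Ricci form as a trace, in matrix form and in an orthonormal frame *)

Section Ricci.
Variables (R : realType) (n : nat) (br : 'rV[R]_n -> 'rV[R]_n -> 'rV[R]_n).
Variable G : 'M[R]_n.
Local Notation vec := 'rV[R]_n.
Hypothesis lie : is_lie_bracket br.
Hypothesis nilp : forall x y z w : vec, br x (br y (br z w)) = 0.
Hypothesis symG : G^T = G.
Hypothesis unitG : G \in unitmx.
Local Notation Gi := (invmx G).
Local Notation ad := (ad br).

(** The Gram matrix of the skew form [(u, w) |-> <[u,w],v>]; [Jmx v *m invmx G] is the associated
    skew-adjoint operator. *)
Definition Jmx (v : vec) : 'M[R]_n := \matrix_(i, k) ip G (br (ebase R i) (ebase R k)) v.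

Lemma JmxE (u w v : vec) : ip G (br u w) v = (u *m Jmx v *m w^T) 0 0.
Proof.
rewrite {1}[u]row_sum_delta {1}[w]row_sum_delta br_sumr // ip_suml mxE.
apply: eq_bigr => k _; rewrite br_suml // ip_suml mxE [w^T _ _]mxE mulr_suml.
by apply: eq_bigr => i _; rewrite !mxE brZl // brZr // !ipZl mulrCA mulrC -mulrA.
Qed.

Lemma Jmx_antisym v : (Jmx v)^T = - Jmx v.
Proof. by apply/matrixP => i j; rewrite !mxE brC // ipNl. Qed.

(** Gram matrix of [ad v] plus its adjoint, that is, twice the self-adjoint part of [ad v]. *)
Definition Smx (v : vec) : 'M[R]_n := ad v *m G + G *m (ad v)^T.

Lemma Smx_sym v : (Smx v)^T = Smx v.
Proof. by rewrite /Smx linearD /= !trmx_mul trmxK symG addrC. Qed.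

(** Matrix of [u |-> L_u v], split into its self-adjoint part (from [Smx]) and its skew-adjoint part
    (from [Jmx]). *)
Definition Rmx (v : vec) : 'M[R]_n := - (2^-1 *: ((Smx v + Jmx v) *m Gi)).

Lemma LC_Rmx u v : LC br G u v = u *m Rmx v.
Proof.
rewrite /LC /Rmx mulmxN -scalemxAr -scalerN mulmxA -mulNmx; congr (_ *: (_ *m _)).
apply/rowP => k; rewrite !mulmxDr.
have entD (A B : vec) : (A + B) 0 k = A 0 k + B 0 k by rewrite mxE.
have entN (A : vec) : (- A) 0 k = - A 0 k by rewrite mxE.
rewrite [LHS]mxE entN !entD !opprD.
rewrite (brC lie u v) ipNl ip_ebase (adE lie v u).
rewrite (brC lie (ebase R k) u) ipNl JmxE.
rewrite (brC lie (ebase R k) v) ipNl (ipC symG) (adE lie v).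
rewrite addrAC -mulmxA; congr (_ - _ - _).
  by rewrite /ip trmx_mul /ebase trmx_delta !mulmxA -colE [LHS]mxE.
by rewrite /ebase trmx_delta -colE [LHS]mxE.
Qed.

Lemma LC_torsion u v : LC br G u v = LC br G v u + br u v.
Proof.
suff <- : LC br G u v - LC br G v u = br u v by rewrite addrC subrK.
rewrite /LC -scalerBr -mulmxBl (_ : _ - _ = 2 *: (br u v *m G)); last first.
  apply/rowP => k; rewrite [LHS]mxE [in LHS]mxE [X in _ + X]mxE [X in _ - X]mxE [RHS]mxE.
  rewrite (brC lie v u) ipNl -ip_ebase; ring.
by rewrite -scalemxAl mulmxK // scalerA mulVf ?scale1r ?pnatr_eq0.
Qed.

Lemma ad_nilp x y z : ad x *m ad y *m ad z = 0.
Proof.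
by apply/row_matrixP => i; rewrite rowE !mulmxA -!adE // nilp row0.
Qed.

Lemma tr_ad x : \tr (ad x) = 0.
Proof. by apply: (@mxtrace_nilpotent _ _ _ 3); rewrite /= mulmx1 mulmxA ad_nilp. Qed.

Lemma tr_ad_ad x y : \tr (ad x *m ad y) = 0.
Proof.
apply: (@mxtrace_nilpotent _ _ _ 2); rewrite /= mulmx1.
by rewrite !mulmxA ad_nilp mul0mx.
Qed.

Lemma trGi : Gi^T = Gi.
Proof. by rewrite trmx_inv symG. Qed.

(** Transposing the product of a self-adjoint and a skew-adjoint operator gives the same trace with
    the opposite sign. *)
Lemma tr_sym_antisym (S J : 'M[R]_n) : S^T = S -> J^T = - J ->
  \tr (S *m Gi *m (J *m Gi)) = 0.
Proof.
move=> hS hJ.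
suff E : \tr (S *m Gi *m (J *m Gi)) = - \tr (S *m Gi *m (J *m Gi)) by lra.
rewrite -[LHS]mxtrace_tr !trmx_mul hS hJ trGi mulmxN mulNmx raddfN /=; congr (- _).
by rewrite [LHS]mxtrace_mulC -!mulmxA [LHS]mxtrace_mulC -!mulmxA.
Qed.

Lemma tr_Rmx v : \tr (Rmx v) = 0.
Proof.
have J0 : \tr (Jmx v *m Gi) = 0.
  have := @tr_sym_antisym G (Jmx v) symG (Jmx_antisym v).
  by rewrite mulmxV // mul1mx.
rewrite /Rmx raddfN /= mxtraceZ mulmxDl mxtraceD J0 /Smx mulmxDl mxtraceD.
rewrite mulmxK // tr_ad -mulmxA mxtrace_mulC -mulmxA mulVmx // mulmx1 mxtrace_tr tr_ad.
by rewrite !addr0 mulr0 oppr0.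
Qed.

(** [K] is the matrix of [w |-> K(u,w)v], where [L_u] is written as [R_u + ad u] because [L] is
    torsion-free. In the trace the two terms with [ad u] cancel by cyclicity, and [R_(L_u v)] is
    traceless. *)
Lemma ric_Rmx u v : ric br G u v = - \tr (Rmx v *m Rmx u).
Proof.
have LCr x w : LC br G x w = w *m (Rmx x + ad x).
  by rewrite LC_torsion LC_Rmx (adE lie x) mulmxDr.
pose K := ad u *m Rmx v - (Rmx v *m (Rmx u + ad u) - Rmx (LC br G u v)).
have -> : ric br G u v = \tr K.
  rewrite /ric /mxtrace; apply: eq_bigr => k _.
  have -> : curv br G u (ebase R k) v = ebase R k *m K.
    by rewrite /curv /K !mulmxBr !mulmxA -!LC_Rmx -adE // -LCr.
  by rewrite /ebase -rowE mxE.
rewrite /K mulmxDr !raddfB /= tr_Rmx !oppr0 addr0 raddfD /=.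
rewrite (mxtrace_mulC (ad u)); ring.
Qed.

Lemma Rmx_linear a v w : Rmx (a *: v + w) = a *: Rmx v + Rmx w.
Proof.
have adl : ad (a *: v + w) = a *: ad v + ad w.
  by apply/matrixP => i j; rewrite !mxE brPl // !mxE.
have Jl : Jmx (a *: v + w) = a *: Jmx v + Jmx w.
  by apply/matrixP => i j; rewrite !mxE ipDr ipZr.
rewrite /Rmx /Smx Jl adl raddfD /= [(a *: ad v)^T]linearZ /= !(mulmxDl, mulmxDr).
rewrite -!(scalemxAl, scalemxAr); apply/matrixP => i j; rewrite !(mxE _ _ i j); ring.
Qed.

Lemma ric_linear u a v w : ric br G u (a *: v + w) = a * ric br G u v + ric br G u w.
Proof.
by rewrite !ric_Rmx Rmx_linear mulmxDl -scalemxAl mxtraceD mxtraceZ opprD mulrN.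
Qed.

Lemma ric_ebase u w : ric br G u w = \sum_k w 0 k * ric br G u (ebase R k).
Proof.
have ric0 : ric br G u 0 = 0.
  have := ric_linear u 1 0 0; rewrite scaler0 addr0 mul1r => h.
  by apply: (addrI (ric br G u 0)); rewrite addr0 -h.
rewrite {1}[w]row_sum_delta (big_morph _ (_ : {morph ric br G u : x y / x + y}) ric0).
  by apply: eq_bigr => k _; rewrite -[X in ric _ _ _ X]addr0 ric_linear ric0 addr0.
by move=> x y; rewrite -[x in LHS]scale1r ric_linear mul1r.
Qed.

(** The mixed self-adjoint and skew-adjoint terms have zero trace. Of the four terms in the product
    of the self-adjoint parts, [ad v ad u] and its adjoint are traceless by nilpotency, and the
    other two are equal. *)
Lemma ric_mx u v : ric br G u v =
  - 2^-1 * \tr (ad v *m G *m (ad u)^T *m Gi) - 4^-1 * \tr (Jmx v *m Gi *m (Jmx u *m Gi)).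
Proof.
rewrite ric_Rmx /Rmx mulmxN mulNmx opprK -scalemxAl -scalemxAr scalerA mxtraceZ.
have expand (A B C D : 'M[R]_n) : (A + B) *m Gi *m ((C + D) *m Gi) =
    A *m Gi *m (C *m Gi) + A *m Gi *m (D *m Gi) + (B *m Gi *m (C *m Gi) + B *m Gi *m (D *m Gi)).
  by rewrite !mulmxDl !mulmxDr.
rewrite expand !mxtraceD (tr_sym_antisym (Smx_sym v) (Jmx_antisym u)).
rewrite (mxtrace_mulC (Jmx v *m Gi)) (tr_sym_antisym (Smx_sym u) (Jmx_antisym v)).
rewrite addr0 add0r.
have -> : \tr (Smx v *m Gi *m (Smx u *m Gi)) = 2 * \tr (ad v *m G *m (ad u)^T *m Gi).
  have SE x : Smx x *m Gi = ad x + G *m (ad x)^T *m Gi by rewrite /Smx mulmxDl mulmxK.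
  rewrite !SE mulmxDl !mulmxDr !mxtraceD tr_ad_ad add0r.
  have -> : \tr (G *m (ad v)^T *m Gi *m (G *m (ad u)^T *m Gi)) = 0.
    rewrite -!mulmxA (mulmxA Gi G) mulVmx // mul1mx mxtrace_mulC -!mulmxA mulVmx // mulmx1.
    by rewrite -trmx_mul mxtrace_tr tr_ad_ad.
  have -> : \tr (G *m (ad v)^T *m Gi *m ad u) = \tr (ad v *m G *m (ad u)^T *m Gi).
    rewrite -[LHS]mxtrace_tr !trmx_mul trmxK symG trGi.
    by rewrite [LHS]mxtrace_mulC -!mulmxA [LHS]mxtrace_mulC -!mulmxA.
  by rewrite addr0 !mulmxA; ring.
by lra.
Qed.

(** [Ric] is built from the values of [ric] on coordinate vectors only; linearity of [ric] in its
    second argument recovers the whole form. *)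
Lemma einstein_ric lam : (forall u, Ric br G u = lam *: u) ->
  forall u w, ric br G u w = lam * ip G u w.
Proof.
move=> h u w; have E : \row_k ric br G u (ebase R k) = lam *: u *m G.
  by rewrite -h /Ric mulmxKV.
rewrite ric_ebase -ipZl /ip -E mxE; apply: eq_bigr => k _.
by rewrite mulrC; congr (_ * _); rewrite mxE.
Qed.

(** Substituting the rank-one expansion of the inverse Gram matrix turns each trace of [ric_mx] into
    a sum of scalars. *)
Theorem ric_frame (I : finType) (f : I -> vec) (s : I -> R) u v :
  Gi = \sum_i s i *: ((f i)^T *m f i) ->
  ric br G u v =
    - 2^-1 * (\sum_i s i * ip G (br u (f i)) (br v (f i)))
    + 4^-1 * (\sum_i \sum_j s i * s j * ip G (br (f i) (f j)) u * ip G (br (f i) (f j)) v).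
Proof.
move=> GiE; rewrite ric_mx; congr (_ * _ + _).
  rewrite GiE mulmx_sumr raddf_sum; apply: eq_bigr => i _ /=.
  rewrite -scalemxAr mxtraceZ mulmxA mxtrace_mulC !mulmxA; congr (_ * _).
  by rewrite (ipC symG) /ip !(adE lie) trmx_mul !mulmxA /mxtrace big_ord1.
rewrite -mulrN; congr (_ * _).
rewrite GiE [Jmx v *m _]mulmx_sumr mulmx_suml (raddf_sum (@mxtrace R n)) -sumrN /=.
apply: eq_bigr => i _ /=.
rewrite [Jmx u *m _]mulmx_sumr mulmx_sumr (raddf_sum (@mxtrace R n)) -sumrN; apply: eq_bigr => j _ /=.
rewrite -[Jmx v *m _]scalemxAr -[Jmx u *m _]scalemxAr -scalemxAl -scalemxAr !mxtraceZ.
rewrite !mulmxA mxtrace_mulC !mulmxA -2!mulmxA (mulmxA (f i) (Jmx u)).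
rewrite /mxtrace big_ord1 mxE big_ord1 -!JmxE.
rewrite (brC lie (f j) (f i)) ipNl; ring.
Qed.
End Ricci.

(** * Lorentzian forms and orthonormal frames *)

Section Frames.
Variables (R : realType) (n : nat) (G : 'M[R]_n).
Local Notation vec := 'rV[R]_n.
Hypothesis symG : G^T = G.

Lemma lorentzian_unit : lorentzian G -> G \in unitmx.
Proof.
move=> [_ [P [i0 [uP E]]]].
have : P *m G *m P^T \in unitmx.
  rewrite E; have -> : \matrix_(i, j) (if i == j then if i == i0 then -1 else 1 else 0) =
    diag_mx (\row_j (if j == i0 then -1 else 1 : R)).
    by apply/matrixP => i j; rewrite !mxE; case: eqVneq => [->|].
  rewrite unitmxE det_diag unitfE; apply/prodf_neq0 => i _; rewrite mxE.
  by case: ifP => _; rewrite ?oppr_eq0 oner_eq0.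
by rewrite !unitmx_mul => /andP[/andP[]].
Qed.

(** [f] reads the coordinate along the negative direction; on its kernel the form is a sum of
    squares. *)
Lemma lorentzian_hyperplane : lorentzian G -> exists f : 'cV[R]_n,
  forall w : vec, (w *m f) 0 0 = 0 -> 0 <= ip G w w /\ (ip G w w = 0 -> w = 0).
Proof.
move=> [_ [P [i0 [uP E]]]].
exists (col i0 (invmx P)) => w w0.
pose a := w *m invmx P.
have wE : w = a *m P by rewrite /a mulmxKV.
have a0 : a 0 i0 = 0 by rewrite -w0 !mxE; apply: eq_bigr => j _; rewrite [X in _ = _ * X]mxE.
clearbody a.
have ipE : ip G w w = \sum_i a 0 i ^+ 2.
  rewrite /ip wE trmx_mul !mulmxA -!(mulmxA a) E mxE; apply: eq_bigr => i _.
  rewrite expr2; congr (_ * _); rewrite mxE (bigD1 i) //= big1 => [|j ji]; last first.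
    by rewrite mxE eq_sym (negPf ji) mul0r.
  rewrite !mxE eqxx addr0; case: eqVneq => [->|_]; last by rewrite mul1r.
  by rewrite a0 mulr0.
split; first by rewrite ipE sumr_ge0 // => i _; apply: sqr_ge0.
rewrite ipE => /eqP; rewrite psumr_eq0 => [/allP h|i _]; last exact: sqr_ge0.
rewrite wE (_ : a = 0) ?mul0mx //; apply/rowP => i.
by have := h i (mem_index_enum _); rewrite mxE /= sqrf_eq0 => /eqP.
Qed.

(** Otherwise the form is nonpositive on the plane of [x] and [y]. That plane meets the hyperplane
    of [lorentzian_hyperplane], and the combination [b x - a y] found there has negative square if
    [b] is nonzero; if [b = 0], [y] itself lies in the hyperplane. *)
Lemma timelike_orthogonal : lorentzian G -> forall x y : vec,
  ip G x x < 0 -> ip G x y = 0 -> y != 0 -> 0 < ip G y y.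
Proof.
move=> /lorentzian_hyperplane [f hf] x y x0 xy y0.
rewrite ltNge; apply/negP => yy.
pose a := (x *m f) 0 0; pose b := (y *m f) 0 0.
have [b0|b0] := eqVneq b 0.
  have [h1 h2] := hf y b0; case/eqP: y0; apply: h2; apply/eqP.
  by rewrite eq_le yy h1.
have [|h _] := hf (b *: x - a *: y).
  have entry (A B : 'M[R]_1) : (b *: A - a *: B) 0 0 = b * A 0 0 - a * B 0 0 by rewrite !mxE.
  by rewrite mulmxBl -!scalemxAl entry -/a -/b mulrC subrr.
move: h; rewrite ipBl !ipBr !ipZl !ipZr (ipC symG y x) xy.
have : 0 < b ^+ 2 by rewrite lt_def sqr_ge0 sqrf_eq0 b0.
have := sqr_ge0 a; nra.
Qed.

Lemma ip_row k m (A : 'M[R]_(k, n)) (B : 'M[R]_(m, n)) i j :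
  ip G (row i A) (row j B) = (A *m G *m B^T) i j.
Proof.
rewrite /ip -row_mul [LHS]mxE [RHS]mxE; apply: eq_bigr => l _.
by congr (_ * _); rewrite [LHS]mxE // [RHS]mxE mxE.
Qed.

Lemma exists_timelike : lorentzian G -> exists x : vec, ip G x x < 0.
Proof.
move=> [_ [P [i0 [uP E]]]]; exists (row i0 P).
by rewrite ip_row E mxE !eqxx ltrN10.
Qed.

(** Diagonalise the Gram matrix of a basis of the row space. Some [d i] may vanish, since the
    subspace may be degenerate. *)
Lemma orthogonal_basis_sub p (K : 'M[R]_(p, n)) :
  exists k (z : 'I_k -> vec) (d : 'I_k -> R),
    [/\ forall i, (z i <= K)%MS, forall i, z i != 0,
        forall i j, ip G (z i) (z j) = if i == j then d i else 0 &
        forall x : vec, (x <= K)%MS -> exists c, x = \sum_i c i *: z i].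
Proof.
have := row_base_free K; have := eq_row_base K; move: (row_base K) => X eqX freeX.
have [|O [d [OO Od]]] := @symmetric_diagonalization R _ (X *m G *m X^T).
  by rewrite !trmx_mul trmxK symG mulmxA.
have O'O : O^T *m O = 1%:M by apply: mulmx1C.
exists (\rank K), (fun i => row i (O *m X)), (fun i => d 0 i); split.
- move=> i; rewrite (submx_trans (row_sub _ _)) //.
  by rewrite (submx_trans (submxMl _ _)) // eqX.
- move=> i; apply/negP; rewrite rowE mulmxA => /eqP.
  move/(congr1 (mulmx^~ (pinvmx X))); rewrite mul0mx -(mulmxA _ X) mulmxVp //.
  rewrite mulmx1 => /(congr1 (mulmx^~ O^T)); rewrite mul0mx -(mulmxA _ O) OO mulmx1.
  by move/rowP/(_ i)/eqP; rewrite !mxE !eqxx oner_eq0.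
- move=> i j; have -> : ip G (row i (O *m X)) (row j (O *m X)) = (diag_mx d) i j.
    by rewrite ip_row trmx_mul !mulmxA -Od !mulmxA.
  by rewrite mxE; case: eqVneq => // _; rewrite mulr1n.
move=> x; rewrite -eqX => /submxP [y ->].
exists (fun i => (y *m O^T) 0 i).
rewrite -[y in LHS](mulmx1 _) -O'O mulmxA -mulmxA mulmx_sum_row.
by [].
Qed.

(** A vanishing [d i] would put [z i] in the radical; otherwise [z i] is rescaled by the inverse
    square root of [|d i|]. *)
Lemma orthonormal_basis_sub p (K : 'M[R]_(p, n)) :
  (forall x : vec, (x <= K)%MS -> (forall y : vec, (y <= K)%MS -> ip G x y = 0) -> x = 0) ->
  exists k (z : 'I_k -> vec) (s : 'I_k -> R),
    [/\ forall i, (z i <= K)%MS, forall i, s i = 1 \/ s i = -1,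
        forall i j, ip G (z i) (z j) = if i == j then s i else 0 &
        forall x : vec, (x <= K)%MS -> x = \sum_i (s i * ip G x (z i)) *: z i].
Proof.
move=> nondeg; have [k [z [d [zK z0 zz span]]]] := orthogonal_basis_sub K.
have d0 i : d i != 0.
  apply: contraNneq (z0 i) => di; apply/eqP/nondeg => // y /span [c ->].
  rewrite ip_sumr big1 // => j _; rewrite ipZr zz; case: eqP => _; rewrite ?di mulr0 //.
pose c i := (Num.sqrt `|d i|)^-1.
have c0 i : c i != 0 by rewrite invr_eq0 sqrtr_eq0 -ltNge normr_gt0.
have cc i : c i * c i * d i = Num.sg (d i).
  rewrite /c -invfM -expr2 sqr_sqrtr //.
  case: (ltrgt0P (d i)) => h; last by case/eqP: (d0 i).
    by rewrite gtr0_sg // mulVf.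
  by rewrite ltr0_sg // invrN mulNr mulVf.
exists k, (fun i => c i *: z i), (fun i => Num.sg (d i)).
have ss i : Num.sg (d i) * Num.sg (d i) = 1.
  by rewrite -expr2 sqr_sg d0.
have ort i j : ip G (c i *: z i) (c j *: z j) = if i == j then Num.sg (d i) else 0.
  rewrite ipZl ipZr zz; case: eqVneq => [<-|_]; last by rewrite !mulr0.
  by rewrite mulrA cc.
split=> //.
- by move=> i; rewrite scalemx_sub.
- by move=> i; have := d0 i; case: sgrP => //; [left|right].
move=> x /span [a ->]; apply: eq_bigr => i _.
rewrite ipZr ip_suml (bigD1 i) //= big1 => [|j ji]; last first.
  by rewrite ipZl zz (negPf ji) mulr0.
rewrite ipZl zz eqxx addr0 scalerA; congr (_ *: _).
have h := ss i; rewrite -{2}cc in h.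
by rewrite -[LHS]mul1r -h; ring.
Qed.

(** An orthonormal basis indexed by any finite type, so that frames can be glued along sum types. *)
Definition frame (I : finType) (f : I -> vec) (s : I -> R) : Prop :=
  [/\ forall i, s i = 1 \/ s i = -1,
      forall i j, ip G (f i) (f j) = if i == j then s i else 0 &
      forall x, x = \sum_i (s i * ip G x (f i)) *: f i].

Lemma frame_invmx (I : finType) (f : I -> vec) (s : I -> R) :
  frame f s -> invmx G = \sum_i s i *: ((f i)^T *m f i).
Proof.
move=> [_ _ span].
have GM : G *m (\sum_i s i *: ((f i)^T *m f i)) = 1%:M.
  apply/row_matrixP => k; rewrite rowE [RHS]rowE mulmx1 [RHS]span mulmxA mulmx_sumr.
  apply: eq_bigr => i _; rewrite -scalemxAr !mulmxA ip_mx mul_scalar_mx scalerA.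
  by [].
by apply: (can_inj (mulKmx (mulmx1_unit GM).1)); rewrite GM mulmxV // (mulmx1_unit GM).1.
Qed.

(** [P] is the orthogonal projection onto the span of [f]; the image of [1 - P] is the orthogonal
    complement, which inherits nondegeneracy from [G] and so has an orthonormal basis. *)
Lemma frame_extension (I : finType) (f : I -> vec) (s : I -> R) :
  G \in unitmx ->
  (forall i, s i = 1 \/ s i = -1) ->
  (forall i j, ip G (f i) (f j) = if i == j then s i else 0) ->
  exists m (g : 'I_m -> vec) (t : 'I_m -> R),
    frame (fun i : I + 'I_m => match i with inl a => f a | inr b => g b end)
          (fun i : I + 'I_m => match i with inl a => s a | inr b => t b end).
Proof.
move=> uG s1 ort.
have ss i : s i * s i = 1 by case: (s1 i) => ->; rewrite ?mulrNN mulr1.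
pose P := \sum_i s i *: (G *m (f i)^T *m f i).
have PE x : x *m P = \sum_i (s i * ip G x (f i)) *: f i.
  rewrite mulmx_sumr; apply: eq_bigr => i _.
  by rewrite -scalemxAr !mulmxA ip_mx mul_scalar_mx scalerA.
have PQ x j : ip G (x *m (1%:M - P)) (f j) = 0.
  rewrite mulmxBr mulmx1 PE ipBl ip_suml (bigD1 j) //= big1 => [|i ij]; last first.
    by rewrite ipZl ort (negPf ij) mulr0.
  by rewrite ipZl ort eqxx addr0 mulrAC ss mul1r subrr.
have Q0 x : (x <= 1%:M - P)%MS -> forall j, ip G x (f j) = 0.
  by move=> /submxP [y ->] j.
have nondeg x : (x <= 1%:M - P)%MS ->
    (forall y : vec, (y <= 1%:M - P)%MS -> ip G x y = 0) -> x = 0.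
  move=> xQ h; suff xG : x *m G = 0 by rewrite -(mulmxK uG x) xG mul0mx.
  apply/rowP => k; rewrite -ip_ebase mxE.
  have -> : ebase R k = ebase R k *m P + ebase R k *m (1%:M - P).
    by rewrite mulmxBr mulmx1 addrC subrK.
  rewrite ipDr (h _ (submxMl _ _)) addr0 PE ip_sumr big1 // => i _.
  by rewrite ipZr (Q0 x) // mulr0.
have [m [g [t [gQ t1 gort gspan]]]] := orthonormal_basis_sub nondeg.
exists m, g, t; split=> [[]//|[i|i] [j|j]|x] //=.
- by rewrite ipC // Q0.
- by rewrite Q0.
rewrite big_sumType /= -PE -[X in _ = _ + X]/(\sum_i (t i * ip G x (g i)) *: g i).
have xE : x = x *m P + x *m (1%:M - P) by rewrite mulmxBr mulmx1 addrC subrK.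
rewrite {1}xE; congr (_ + _); rewrite [LHS]gspan ?submxMl //; apply: eq_bigr => i _.
rewrite {2}xE ipDl PE ip_suml big1 ?add0r // => j _.
by rewrite ipZl (ipC symG (f j)) (Q0 (g i)) // mulr0.
Qed.
End Frames.

(** * The equations on the structure constants *)

Section Numeric.
Variables (R : realFieldType) (J : finType) (mu del : J -> R) (t : J -> J -> J -> R).
Variables (lam : R) (o : J).
(** The sign conditions express that [C] is Lorentzian, [cyclic] is the [e]-component of the Jacobi
    identity, [t_deg] records that [y_k = 0] when [mu k = 0], and [del_deg] comes from
    [ric(v_b, y_a) = 0]. *)
Hypothesis mu_o : mu o < 0.
Hypothesis mu_ge0 : forall i, i != o -> 0 <= mu i.
Hypothesis anti : forall k a b, t k a b = - t k b a.
Hypothesis cyclic : forall i a b, t i a b + t a b i + t b i a = 0.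
Hypothesis t_deg : forall k a b, mu k = 0 -> t k a b = 0.
Hypothesis del_ge0 : forall a, 0 <= del a.
Hypothesis del_deg : forall a, mu a != 0 -> del a = 0.
(* The Einstein equations on [y_k], [v_a] and [e], for an Einstein constant [lam]
   and [del a = sum_b <[v_a,v_b],e>^2]; the convention [1/0 = 0] discards the
   indices with [mu k = 0]. *)
Hypothesis E1 : forall k, \sum_a \sum_b t k a b ^+ 2 = 4 * lam * mu k + 2 * mu k ^+ 2.
Hypothesis E2 : forall a, - (\sum_b \sum_k t k a b ^+ 2 / mu k) = 2 * lam + mu a + del a.
Hypothesis E3 : \sum_a del a + 2 * \sum_a mu a = 4 * lam.

Lemma taa k a : t k a a = 0.
Proof. by have := anti k a a; lra. Qed.

Lemma sum_sym_split (h : J -> J -> R) : (forall a b, h a b = h b a) -> h o o = 0 ->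
  \sum_a \sum_b h a b =
    2 * (\sum_b h o b) + \sum_(a | a != o) \sum_(b | b != o) h a b.
Proof.
move=> hC h0; rewrite (bigD1 o) //=.
have -> : \sum_(i | i != o) \sum_b h i b =
   \sum_(i | i != o) h i o + \sum_(a | a != o) \sum_(b | b != o) h a b.
  by rewrite -big_split; apply: eq_bigr => i _ /=; rewrite (bigD1 o).
rewrite (bigD1 o) //= h0 add0r.
have -> : \sum_(i | i != o) h i o = \sum_(i | i != o) h o i.
  by apply: eq_bigr => i _; rewrite hC.
by ring.
Qed.

(** Summing [E1] divided by [mu k], summing [E2], and using [E3] give
    [M = - lam (4 p + 2 #|J| + 4)]; then [D >= 0] forces [lam >= 0]. Separating the index [o] gives
    [- 2 A + U = 4 lam p + 2 M], with a nonnegative left side and a nonpositive right side, so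
    everything vanishes. *)
Lemma rigidity : [/\ lam = 0, forall a, del a = 0, forall b, t o o b = 0 &
  forall k a b, k != o -> a != o -> b != o -> t k a b = 0].
Proof.
(* Under [1/0 = 0], dividing [E1] by [mu k] keeps only nonzero [mu k], and [p] counts them. *)
pose p : R := \sum_k (mu k != 0)%:R.
pose M := \sum_a mu a; pose D := \sum_a del a.
pose F k := \sum_a \sum_b t k a b ^+ 2 / mu k.
have FE k : F k = 4 * lam * (mu k != 0)%:R + 2 * mu k.
  rewrite /F; under eq_bigr => a _ do rewrite -mulr_suml.
  rewrite -mulr_suml E1; have [->|k0] := eqVneq (mu k) 0; first by rewrite invr0 /=; ring.
  by rewrite /=; field.
have sF : \sum_k F k = 4 * lam * p + 2 * M.
  by under eq_bigr => k _ do rewrite FE; rewrite big_split -!mulr_sumr.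
have sE2 : - \sum_k F k = 2 * lam * #|J|%:R + M + D.
  transitivity (\sum_a (2 * lam + mu a + del a)).
    rewrite -(eq_bigr _ (fun a _ => E2 a)) sumrN; congr (- _).
    rewrite exchange_big; apply: eq_bigr => a _ /=.
    by rewrite exchange_big.
  by rewrite !big_split /= sumr_const mulr_natr.
have p_ge0 : 0 <= p by apply: sumr_ge0 => k _; rewrite ler0n.
have m_ge0 : 0 <= #|J|%:R :> R by rewrite ler0n.
have D_ge0 : 0 <= D by apply: sumr_ge0.
(* [A], [B] and [U] sort the quotients [t k a b ^+ 2 / mu k]: [k = a = o] in [A], only [a = o] in
   [B], and no index equal to [o] in [U]. *)
pose A := \sum_b t o o b ^+ 2 / mu o.
have A_le0 : A <= 0.
  apply: sumr_le0 => b _; rewrite ler_ndivrMr // mul0r; exact: sqr_ge0.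
pose B := \sum_(k | k != o) \sum_b t k o b ^+ 2 / mu k.
have EAB : - (A + B) = 2 * lam + mu o.
  have := E2 o; rewrite (del_deg (ltr0_neq0 mu_o)) addr0 => <-; congr (- _).
  by rewrite [RHS]exchange_big /= [RHS](bigD1 o).
pose U := \sum_(k | k != o) \sum_(a | a != o) \sum_(b | b != o) t k a b ^+ 2 / mu k.
have U0 k a b : k != o -> 0 <= t k a b ^+ 2 / mu k.
  by move=> ko; rewrite divr_ge0 ?sqr_ge0 // mu_ge0.
have U_ge0 : 0 <= U.
  by apply: sumr_ge0 => k ko; do 2 (apply: sumr_ge0 => ? _); apply: U0.
have FBU : \sum_(k | k != o) F k = 2 * B + U.
  rewrite /B mulr_sumr -big_split; apply: eq_bigr => k ko /=.
  rewrite /F sum_sym_split ?taa ?expr0n ?mul0r // => a b.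
  by rewrite anti sqrrN.
have FP : \sum_(k | k != o) F k = 4 * lam * (p - 1) + 2 * (M - mu o).
  move: sF; rewrite (bigD1 o) //= FE (ltr0_neq0 mu_o) /= => h; lra.
have EM : M = - lam * (4 * p + 2 * #|J|%:R + 4) by move: E3 sE2; rewrite sF -/D -/M; lra.
have EU : - (2 * A) + U = 4 * lam * p + 2 * M by lra.
have lam_ge0 : 0 <= lam.
  have : 0 <= lam * (8 * p + 4 * #|J|%:R + 12) by move: E3; rewrite -/M -/D; lra.
  by rewrite pmulr_lge0 //; lra.
have lp : 0 <= lam * p by rewrite mulr_ge0.
have lm : 0 <= lam * #|J|%:R by rewrite mulr_ge0.
have lam0 : lam = 0 by lra.
have A0 : A = 0 by rewrite lam0 in EM EU; lra.
have U00 : U = 0 by rewrite lam0 in EM EU; lra.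
have D0 : D = 0 by move: E3; rewrite -/M -/D EM lam0; lra.
split=> //.
- by move=> a; apply/eqP; have /eqP := D0; rewrite psumr_eq0 // => /allP/(_ a (mem_index_enum _)).
- move=> b; have /eqP := A0; rewrite -oppr_eq0 -sumrN psumr_eq0 => [|i _]; last first.
    by rewrite -mulrN -invrN divr_ge0 ?sqr_ge0 ?oppr_ge0 ?ltW.
  move/allP/(_ b (mem_index_enum _)); rewrite /= oppr_eq0 mulf_eq0 invr_eq0 (negPf (ltr0_neq0 mu_o)) orbF.
  by rewrite sqrf_eq0 => /eqP.
move=> k a b ko ao bo.
have [mk|mk] := eqVneq (mu k) 0; first exact: t_deg.
have /eqP := U00; rewrite psumr_eq0 => [|i ?]; last first.
  by do 2 (apply: sumr_ge0 => ? _); apply: U0.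
move/allP/(_ k (mem_index_enum _)); rewrite ko /= psumr_eq0 => [|i ?]; last first.
  by apply: sumr_ge0 => ? _; apply: U0.
move/allP/(_ a (mem_index_enum _)); rewrite ao /= psumr_eq0 => [|i ?]; last exact: U0.
move/allP/(_ b (mem_index_enum _)); rewrite bo /= mulf_eq0 invr_eq0 (negPf mk) orbF.
by rewrite sqrf_eq0 => /eqP.
Qed.

(** The center meets the span of the [v_a] trivially: the first condition makes [sum_a x_a v_a]
    commute with [C], the second with every [v_b]. *)
Hypothesis nondeg : forall x : J -> R, (forall a, mu a != 0 -> x a = 0) ->
  (forall k b, \sum_a x a * t k a b = 0) -> forall a, x a = 0.

(** Only the indices [o], [a], [b] exist, and [t] is determined by [mu] and a global sign [sg];
    [mu b = 0] remains possible. *)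
Definition structure_shape a b (sg : R) : Prop :=
  [/\ [/\ a != o, b != o, a != b & forall c, [|| c == o, c == a | c == b]],
      sg = 1 \/ sg = -1, [/\ 0 < mu a, 0 <= mu b & mu o = - (mu a + mu b)],
      [/\ t a o b = sg * mu a, t b o a = - (sg * mu b) & t o a b = sg * (mu a + mu b)] &
      [/\ t o o a = 0, t o o b = 0, t a o a = 0, t b o b = 0 & t a a b = 0 /\ t b a b = 0]].

(** Equality of the sums in [balance] holds term by term, so a nonzero entry [N a b] exhausts the
    trace: [mu a + mu b = s]. Every further index [c] then has [mu c = 0], and [nondeg] excludes
    it. *)
Theorem structure_constants : exists a b sg, structure_shape a b sg.
Proof.
have [lam0 del0 too tkab] := rigidity.
pose N k b := t k o b.
pose s := - mu o.
have s_gt0 : 0 < s by rewrite /s oppr_gt0.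
have Ndeg k b : mu k = 0 -> N k b = 0 by exact: t_deg.
have toab a b : t o a b = N a b - N b a.
  by have := cyclic o a b; rewrite /N (anti a b o); lra.
have sE : s = \sum_(k | k != o) mu k.
  move: E3; rewrite lam0 big1 // (bigD1 o) //= /s; lra.
have s_ge a b : a != o -> b != o -> a != b -> mu a + mu b <= s.
  move=> ao bo ab; rewrite sE (bigD1 a) //= (bigD1 b) /= ?bo 1?eq_sym // addrA lerDl.
  by apply: sumr_ge0 => i /andP[/andP[io _] _]; apply: mu_ge0.
have s_rest a b : a != o -> b != o -> a != b -> mu a + mu b = s ->
    forall c, c != o -> c != a -> c != b -> mu c = 0.
  move=> ao bo ab; rewrite sE (bigD1 a) //= (bigD1 b) /= ?bo 1?eq_sym // addrA => h c co ca cb.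
  have /eqP : \sum_(i | (i != o) && (i != a) && (i != b)) mu i = 0 by lra.
  rewrite psumr_eq0 => [|i /andP[/andP[io _] _]]; last exact: mu_ge0.
  by move/allP/(_ c (mem_index_enum _)); rewrite co ca cb /= => /eqP.
have rowN k : k != o -> \sum_(b | b != o) N k b ^+ 2 = mu k ^+ 2.
  move=> ko; have := E1 k; rewrite lam0 mulr0 mul0r add0r sum_sym_split.
  - rewrite [X in _ + X]big1 ?addr0 => [|a ao]; last first.
      by apply: big1 => b bo; rewrite tkab // expr0n.
    rewrite [X in 2 * X](bigD1 o) //= taa expr0n add0r => h.
    by apply: (mulfI (_ : 2 != 0 :> R)); rewrite ?pnatr_eq0.
  - by move=> a b; rewrite anti sqrrN.
  - by rewrite taa expr0n.
pose q a b := N a b ^+ 2 / mu a + N b a ^+ 2 / mu b.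
have q_ge0 a b : a != o -> b != o -> 0 <= q a b.
  by move=> ao bo; rewrite addr_ge0 // divr_ge0 ?sqr_ge0 // mu_ge0.
have balance a : a != o ->
    \sum_(b | b != o) (N a b - N b a) ^+ 2 = \sum_(b | b != o) s * q a b.
  move=> ao; have := E2 a; rewrite lam0 del0 mulr0 add0r addr0.
  rewrite (bigD1 o) //= (bigD1 o) //= anti too oppr0 expr0n mul0r add0r.
  have -> : \sum_(i | i != o) t i a o ^+ 2 / mu i = \sum_(i | i != o) N i a ^+ 2 / mu i.
    by apply: eq_bigr => i _; rewrite anti sqrrN.
  have -> : \sum_(i | i != o) \sum_k t k a i ^+ 2 / mu k =
            \sum_(i | i != o) (N a i - N i a) ^+ 2 / mu o.
    apply: eq_bigr => i io; rewrite (bigD1 o) //= big1 ?addr0 ?toab // => k ko.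
    by rewrite tkab // expr0n mul0r.
  rewrite -mulr_suml => h; rewrite -mulr_sumr big_split /=.
  have -> : \sum_(i | i != o) N a i ^+ 2 / mu a = mu a.
    rewrite -mulr_suml rowN //; have [->|m0] := eqVneq (mu a) 0; first by rewrite expr0n mul0r.
    by field.
  rewrite -h /s; field; exact: ltr0_neq0.
(* The defect of a weighted Cauchy-Schwarz inequality. If [mu a] or [mu b] vanishes, so does the
   corresponding row entry of [N], and with [1/0 = 0] both sides are zero. *)
have pair a b : a != o -> b != o -> a != b ->
    (mu a + mu b) * q a b - (N a b - N b a) ^+ 2 =
      (mu b * N a b + mu a * N b a) ^+ 2 / (mu a * mu b).
  move=> ao bo ab; rewrite /q.
  have [ma|ma] := eqVneq (mu a) 0.
    rewrite (Ndeg a b ma) ma; have [mb|mb] := eqVneq (mu b) 0.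
      by rewrite (Ndeg b a mb) mb !expr0n /=; ring.
    by rewrite !(mul0r, mulr0, add0r, addr0, invr0, expr0n) /= ?mul0r ?add0r; field.
  have [mb|mb] := eqVneq (mu b) 0.
    by rewrite (Ndeg b a mb) mb !(mul0r, mulr0, add0r, addr0, invr0, expr0n) /= ?mul0r ?addr0; field.
  by field; rewrite ma mb.
have pair_ge0 a b : a != o -> b != o ->
    0 <= (mu b * N a b + mu a * N b a) ^+ 2 / (mu a * mu b).
  by move=> ao bo; rewrite divr_ge0 ?sqr_ge0 // mulr_ge0 // mu_ge0.
(* The terms of [balance] satisfy an inequality termwise, hence an equality. *)
have tight a b : a != o -> b != o -> (N a b - N b a) ^+ 2 = s * q a b.
  move=> ao bo.
  have le i : i != o -> 0 <= s * q a i - (N a i - N i a) ^+ 2.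
    move=> io; have qi := q_ge0 _ _ ao io; have [<-|ai] := eqVneq a i.
      by rewrite subrr expr0n subr0 mulr_ge0 ?q_ge0 // ltW.
    have := ler_wpM2r qi (s_ge _ _ ao io ai).
    have := pair _ _ ao io ai; have := pair_ge0 _ _ ao io; lra.
  have /eqP : \sum_(i | i != o) (s * q a i - (N a i - N i a) ^+ 2) = 0.
    by rewrite big_split /= sumrN balance // subrr.
  rewrite psumr_eq0 // => /allP/(_ b (mem_index_enum _)); rewrite bo /= subr_eq0.
  by move=> /eqP ->.
have Naa a : a != o -> N a a = 0.
  move=> ao; have := tight a a ao ao; rewrite subrr expr0n /= => /esym/eqP.
  rewrite mulf_eq0 (gt_eqF s_gt0) /= /q -mulr2n mulrn_eq0 /= mulf_eq0 invr_eq0 sqrf_eq0.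
  by case/orP => /eqP // /Ndeg ->.
have support a b : a != o -> b != o -> a != b -> N a b != 0 ->
    mu a + mu b = s /\ mu b * N a b + mu a * N b a = 0.
  move=> ao bo ab nab.
  have ma : mu a != 0 by apply: contraNneq nab => /Ndeg ->.
  have q_gt0 : 0 < q a b.
    rewrite /q ltr_wpDr ?divr_ge0 ?sqr_ge0 ?mu_ge0 // divr_gt0 //.
      by rewrite lt_def sqrf_eq0 nab sqr_ge0.
    by rewrite lt_def ma mu_ge0.
  have hs := s_ge _ _ ao bo ab; have ht := tight _ _ ao bo.
  have hp := pair _ _ ao bo ab; have hp0 := pair_ge0 _ _ ao bo.
  have e1 : mu a + mu b = s.
    apply/eqP; rewrite eq_le hs /= -(ler_pM2r q_gt0); lra.
  split=> //; move: hp; rewrite e1 ht subrr => /esym/eqP.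
  have [mb|mb] := eqVneq (mu b) 0; first by rewrite (Ndeg b a mb) mb mul0r mulr0 addr0.
  by rewrite mulf_eq0 sqrf_eq0 invr_eq0 (mulf_eq0 (mu a)) (negPf ma) (negPf mb) !orbF => /eqP.
(* The [mu i] with [i != o] add up to [s > 0], so one is positive; its row of [N] has norm [mu a]
   and hence a nonzero entry. *)
have [a ao ma] : exists2 a, a != o & 0 < mu a.
  apply/exists_inP; apply: contraTT s_gt0 => /exists_inPn h; rewrite -leNgt sE.
  by apply: sumr_le0 => i io; rewrite leNgt; apply: h.
have [b bo nab] : exists2 b, b != o & N a b != 0.
  apply/exists_inP; apply: contraTT ma => /exists_inPn h.
  have := rowN a ao; rewrite big1 => [/esym/eqP|i io]; last first.
    by have := h i io; rewrite negbK => /eqP ->; rewrite expr0n.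
  by rewrite sqrf_eq0 => /eqP ->; rewrite ltxx.
have ab : a != b by apply: contraNneq nab => <-; rewrite Naa.
have [eab eN] := support _ _ ao bo ab nab.
have rest := s_rest _ _ ao bo ab eab.
have mb_ge0 := mu_ge0 bo.
have ma0 : mu a != 0 by rewrite gt_eqF.
have cover c : [|| c == o, c == a | c == b].
  rewrite -[X in is_true X]negbK; apply/negP; rewrite !negb_or => /and3P[co ca cb].
  have mc := rest c co ca cb.
  have deltaE i (f : J -> R) : \sum_d (d == i)%:R * f d = f i.
    rewrite (bigD1 i) //= eqxx mul1r big1 ?addr0 // => d /negPf ->.
    by rewrite mul0r.
  (* If [mu b != 0], column [c] of [N] vanishes and [v_c] itself would be central. If [mu b = 0],
     row [a] is the only nonzero row of [N], and [N a c v_b - N a b v_c] would be central. *)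
  have [mb|mb] := eqVneq (mu b) 0; last first.
    have Nac : N a c = 0.
      apply/eqP; apply: contraNT mb => nac; have [] := support a c ao co _ nac; first by rewrite eq_sym.
      by rewrite mc -eab addr0 -[LHS]addr0 => /addrI <-.
    have Nbc : N b c = 0.
      apply/eqP; apply: contraNT ma0 => nbc; have [] := support b c bo co _ nbc; first by rewrite eq_sym.
      by rewrite mc -eab addr0 -[LHS]add0r => /addIr <-.
    have Ndc d : d != o -> N d c = 0.
      move=> do_; have [->//|da] := eqVneq d a; have [->//|db] := eqVneq d b.
      by rewrite Ndeg ?rest.
    suff /(_ c)/eqP : forall d, (d == c)%:R = 0 :> R by rewrite eqxx oner_eq0.
    apply: nondeg => [d|k e].
    - by have [->|//] := eqVneq d c; rewrite mc eqxx.
    - rewrite deltaE; have [->|ko] := eqVneq k o.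
        have [->|eo] := eqVneq e o; first by rewrite anti too oppr0.
        by rewrite toab Ndc // Ndeg // subrr.
      have [->|eo] := eqVneq e o; first by rewrite anti -/(N k c) Ndc ?oppr0.
      by rewrite tkab.
  have Ne e i : e != o -> e != a -> N e i = 0.
    move=> eo ea; have [->|eb] := eqVneq e b; first exact: Ndeg.
    by rewrite Ndeg ?rest.
  suff /(_ c)/eqP : forall d, N a c * (d == b)%:R - N a b * (d == c)%:R = 0.
    by rewrite eqxx (negPf cb) mulr0 mulr1 sub0r oppr_eq0 (negPf nab).
  apply: nondeg => [d|k e].
  - have [->|_] := eqVneq d b; first by rewrite mb eqxx.
    have [->|_] := eqVneq d c; first by rewrite mc eqxx.
    by rewrite !mulr0 subrr.
  - under eq_bigr => d _ do rewrite mulrBl -!mulrA.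
    rewrite big_split sumrN -!mulr_sumr !deltaE /=.
    have [->|ko] := eqVneq k o.
      have [->|eo] := eqVneq e o; first by rewrite !(anti o _ o) !too; ring.
      have ba : b != a by rewrite eq_sym.
      rewrite (toab b) (toab c) (Ne b e bo ba) (Ne c e co ca).
      by have [->|ea] := eqVneq e a; [ring | rewrite !(Ne e) //; ring].
    have [->|eo] := eqVneq e o; last by rewrite !tkab //; ring.
    rewrite !(anti k _ o) -/(N k b) -/(N k c).
    by have [->|ka] := eqVneq k a; [ring | rewrite !(Ne k) //; ring].
(* [N a b] is the only nonzero entry of row [a], whose norm is [mu a], so this quotient is a sign;
   [support] then gives [N b a]. *)
exists a, b, (N a b / mu a).
have Nab : N a b = N a b / mu a * mu a by rewrite divfK.
have Nba : N b a = - (N a b / mu a * mu b).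
  by apply: (mulfI ma0); rewrite mulrN mulrCA mulrA divfK // mulrC; lra.
have sq : (N a b / mu a) ^+ 2 = 1.
  have := rowN a ao; rewrite (bigD1 a) //= Naa // expr0n add0r (bigD1 b) /=; last first.
    by rewrite bo eq_sym.
  rewrite big1 => [|i /andP[/andP[io ia] ib]]; last first.
    by have := cover i; rewrite (negPf io) (negPf ia) (negPf ib).
  by rewrite addr0 expr_div_n => ->; rewrite divff // sqrf_eq0.
split=> //.
- by move/eqP: sq; rewrite sqrf_eq1 => /orP[/eqP|/eqP]; [left|right].
- by split=> //; rewrite eab /s opprK.
- by split=> //; rewrite toab Nba {1}Nab; ring.
- have a_o : t a o a = 0 by exact: Naa.
  have b_o : t b o b = 0 by exact: Naa.
  by split=> //; rewrite !tkab.
Qed.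
End Numeric.

(** * Einstein metrics with non-degenerate one-dimensional center *)

Section Einstein.
Variables (R : realType) (n : nat) (br : 'rV[R]_n -> 'rV[R]_n -> 'rV[R]_n).
Variable G : 'M[R]_n.
Local Notation vec := 'rV[R]_n.
Local Notation ip := (ip G).
Hypothesis lie : is_lie_bracket br.
Hypothesis nilp : forall x y z w : vec, br x (br y (br z w)) = 0.
Hypothesis not2step : exists x y z : vec, br x (br y z) != 0.
Hypothesis lor : lorentzian G.
Let symG : G^T = G. Proof. by case: lor. Qed.
Let unitG : G \in unitmx := lorentzian_unit lor.
Variables (e : vec) (eps : R).
Hypothesis centerE : forall v, in_center br v <-> exists c : R, v = c *: e.
Hypothesis ip_ee : ip e e = eps.
Hypothesis eps1 : eps = 1 \/ eps = -1.
Variable lam : R.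
Hypothesis ricE : forall u v, ric br G u v = lam * ip u v.
Let ipC := ipC symG.

(** * The derived algebra of a 3-step nilpotent Lie algebra with one-dimensional center *)

Definition commutator_mx : 'M[R]_n := (\sum_i ad br (ebase R i))%MS.
Local Notation C := commutator_mx.

Lemma br_commutator x y : (br x y <= C)%MS.
Proof.
rewrite [x]row_sum_delta br_suml //; apply: summx_sub => i _.
rewrite brZl // adE // scalemx_sub //; apply: submx_trans (submxMl _ _) _.
exact: (sumsmx_sup i).
Qed.

Lemma commutator_sum u : (u <= C)%MS -> exists w : 'I_n -> vec, u = \sum_i br (ebase R i) (w i).
Proof.
move=> /sub_sumsmxP [w ->]; exists w; apply: eq_bigr => i _; by rewrite adE.
Qed.

Lemma eps_sq : eps * eps = 1.
Proof. by case: eps1 => ->; rewrite ?mulrNN mulr1. Qed.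

Lemma e_neq0 : e != 0.
Proof.
apply/eqP => e0; have := ip_ee; rewrite e0 ip0l => h.
by have := eps_sq; rewrite -h mul0r => /eqP; rewrite eq_sym oner_eq0.
Qed.

Lemma br_el x : br e x = 0.
Proof. by apply: (centerE e).2; exists 1; rewrite scale1r. Qed.

Lemma br_er x : br x e = 0.
Proof. by rewrite brC // br_el oppr0. Qed.

Lemma central_e v : (forall x, br v x = 0) -> v = (eps * ip v e) *: e.
Proof.
move=> /(centerE v).1 [c ->]; rewrite ipZl ip_ee; congr (_ *: _).
by rewrite mulrCA eps_sq mulr1.
Qed.

(** Brackets with the derived algebra are triple brackets, which are central by nilpotency. *)
Lemma br_comm u x : (u <= C)%MS -> br u x = (eps * ip (br u x) e) *: e.
Proof.
move=> /commutator_sum [w ->]; apply: central_e => y.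
rewrite !(br_suml lie) big1 // => i _.
by rewrite (brC lie _ y) (brC lie _ x) brNr // opprK nilp.
Qed.

(** A nonzero triple bracket is central, hence a nonzero multiple of [e]. *)
Lemma e_commutator : (e <= C)%MS.
Proof.
have [x [y [z h]]] := not2step.
have E := @central_e (br x (br y z)).
have {}E : br x (br y z) = (eps * ip (br x (br y z)) e) *: e.
  by apply: E => w; rewrite brC // nilp oppr0.
have c0 : eps * ip (br x (br y z)) e != 0.
  by apply: contraNneq h => h; rewrite E h scale0r.
have -> : e = (eps * ip (br x (br y z)) e)^-1 *: br x (br y z).
  by rewrite {2}E scalerA mulVf // scale1r.
by rewrite scalemx_sub // br_commutator.
Qed.

(** Jacobi for [u] and a bracket [[e_i, w_i]]: the other two terms are brackets with multiples of
    [e]. *)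
Lemma br_comm_comm u v : (u <= C)%MS -> (v <= C)%MS -> br u v = 0.
Proof.
move=> uC /commutator_sum [w ->]; rewrite br_sumr // big1 // => i _.
have := jacobi lie u (ebase R i) (w i).
rewrite (br_comm (ebase R i) uC) brZr // br_er scaler0 addr0.
rewrite (brC lie (w i) u) (br_comm (w i) uC) brNr // brZr // br_er scaler0 oppr0 addr0.
by [].
Qed.

(** The contradiction aimed at below: a central derived algebra would make the Lie algebra 2-step
    nilpotent. *)
Lemma not_all_central : ~ (forall u x, (u <= C)%MS -> br u x = 0).
Proof.
move=> h; have [x [y [z]]] := not2step; rewrite brC // h ?br_commutator //.
by rewrite oppr0 eqxx.
Qed.

(** * Ricci curvature in a frame split into two families *)

Section FrameSum.
Variables (I J : finType) (f : I -> vec) (s : I -> R) (g : J -> vec) (t : J -> R).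
Definition fcat (i : I + J) : vec := match i with inl a => f a | inr b => g b end.
Definition scat (i : I + J) : R := match i with inl a => s a | inr b => t b end.
Hypothesis fr : frame G fcat scat.

Lemma ric_fcat u v : ric br G u v =
  - 2^-1 * (\sum_i s i * ip (br u (f i)) (br v (f i)) + \sum_j t j * ip (br u (g j)) (br v (g j)))
  + 4^-1 * (\sum_i \sum_i' s i * s i' * ip (br (f i) (f i')) u * ip (br (f i) (f i')) v
     + 2 * (\sum_i \sum_j s i * t j * ip (br (f i) (g j)) u * ip (br (f i) (g j)) v)
     + \sum_j \sum_j' t j * t j' * ip (br (g j) (g j')) u * ip (br (g j) (g j')) v).
Proof.
rewrite (ric_frame lie nilp symG unitG u v (frame_invmx fr)) !big_sumType /=.
congr (_ * _ + _ * _).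
under eq_bigr => i _ do rewrite big_sumType /=.
under [X in _ + X = _]eq_bigr => i _ do rewrite big_sumType /=.
rewrite !big_split /=.
have -> : \sum_j \sum_i t j * s i * ip (br (g j) (f i)) u * ip (br (g j) (f i)) v =
   \sum_i \sum_j s i * t j * ip (br (f i) (g j)) u * ip (br (f i) (g j)) v.
  rewrite exchange_big; apply: eq_bigr => i _; apply: eq_bigr => j _ /=.
  by rewrite (brC lie (g j)) !ipNl; ring.
by ring.
Qed.

Lemma frame_ipE x y : ip x y = \sum_i s i * ip x (f i) * ip y (f i)
                             + \sum_j t j * ip x (g j) * ip y (g j).
Proof.
have [_ _ span] := fr.
rewrite {1}[x]span big_sumType /= ipDl !ip_suml.
by congr (_ + _); apply: eq_bigr => i _; rewrite ipZl (ipC _ y).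
Qed.

Lemma frame_spanE x : x = \sum_i (s i * ip x (f i)) *: f i + \sum_j (t j * ip x (g j)) *: g j.
Proof. by have [_ _ span] := fr; rewrite {1}[x]span big_sumType. Qed.

Lemma frame_central u : (forall i, br u (f i) = 0) -> (forall j, br u (g j) = 0) ->
  forall x, br u x = 0.
Proof.
move=> hf hg x; rewrite [x]frame_spanE (brDr lie) !(br_sumr lie).
rewrite [X in X + _]big1 => [|i _]; last by rewrite brZr // hf scaler0.
by rewrite add0r big1 // => j _; rewrite brZr // hg scaler0.
Qed.

Lemma frame_f i i' : ip (f i) (f i') = if i == i' then s i else 0.
Proof. by have [_ /(_ (inl i) (inl i')) h _] := fr. Qed.
Lemma frame_g i i' : ip (g i) (g i') = if i == i' then t i else 0.
Proof. by have [_ /(_ (inr i) (inr i')) h _] := fr. Qed.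
Lemma frame_fg i j : ip (f i) (g j) = 0.
Proof. by have [_ /(_ (inl i) (inr j)) h _] := fr. Qed.

Lemma frame_sign_t j : t j = 1 \/ t j = -1.
Proof. by have [/(_ (inr j)) h _ _] := fr. Qed.

Lemma timelike_sign x : ip x x < 0 -> forall j, ip x (g j) = 0 -> t j = 1.
Proof.
move=> x0 j xg; have tj := frame_g j j; rewrite eqxx in tj.
have := timelike_orthogonal symG lor x0 xg; rewrite tj.
case: (frame_sign_t j) tj => ->// tj h.
have : 0 < -1 :> R by apply: h; apply/eqP => g0; move: tj; rewrite g0 ip0l; lra.
by lra.
Qed.

Lemma ric_fcat_perp u v : (forall x y, ip (br x y) u = 0) -> ric br G u v =
  - 2^-1 * (\sum_i s i * ip (br u (f i)) (br v (f i)) + \sum_j t j * ip (br u (g j)) (br v (g j))).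
Proof.
move=> h; rewrite ric_fcat [X in 4^-1 * X](_ : _ = 0) ?mulr0 ?addr0 //.
rewrite ![X in 2 * X]big1 ?mulr0 ?addr0 => [|i _]; last first.
  by apply: big1 => j _; rewrite h mulr0 mul0r.
by rewrite !big1 ?addr0 // => i _; apply: big1 => j _; rewrite h mulr0 mul0r.
Qed.

Lemma ric_fcat_comm u v : (forall i, (f i <= C)%MS) -> ric br G u v =
  - 2^-1 * (\sum_i s i * ip (br u (f i)) (br v (f i)) + \sum_j t j * ip (br u (g j)) (br v (g j)))
  + 4^-1 * (2 * (\sum_i \sum_j s i * t j * ip (br (f i) (g j)) u * ip (br (f i) (g j)) v)
     + \sum_j \sum_j' t j * t j' * ip (br (g j) (g j')) u * ip (br (g j) (g j')) v).
Proof.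
move=> fC; rewrite ric_fcat; congr (_ + _ * (_ + _)); rewrite [X in X + _]big1 ?add0r // => i _.
by apply: big1 => i' _; rewrite br_comm_comm // ip0l mulr0 mul0r.
Qed.
End FrameSum.

(** If [e] is timelike, the rest of the frame is spacelike, and [ric(e,e) >= 0] gives [lam <= 0].
    For [u] in [C] orthogonal to [e] the brackets [[u,g_j]] are timelike or zero, so [ric(u,u)] is
    nonnegative while [lam <u,u>] is nonpositive. All these brackets vanish and [C] is central. *)
Lemma center_spacelike : eps = 1.
Proof.
case: eps1 => // em; exfalso.
have [||m [g [t fr]]] := @frame_extension _ _ _ symG 'I_1 (fun=> e) (fun=> -1) unitG.
- by move=> _; right.
- by move=> i j; rewrite !ord1 eqxx ip_ee.
have {}fr : frame G (fcat (fun _ : 'I_1 => e) g) (scat (fun _ : 'I_1 => -1) t) by [].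
have t1 j : t j = 1.
  by apply: (timelike_sign fr (x := e)); rewrite ?ip_ee ?em ?(frame_fg fr ord0) // ltrN10.
have lam_le0 : lam <= 0.
  have := ricE e e; rewrite (ric_fcat_comm fr _ _ (fun=> e_commutator)) ip_ee em !big_ord1 br_el ip0l mulr0.
  have -> : \sum_j t j * ip (br e (g j)) (br e (g j)) = 0.
    by apply: big1 => j _; rewrite br_el ip0l mulr0.
  have -> : \sum_j -1 * t j * ip (br e (g j)) e * ip (br e (g j)) e = 0.
    by apply: big1 => j _; rewrite br_el ip0l mulr0.
  set D := \sum_j _; have : 0 <= D.
    apply: sumr_ge0 => j _; apply: sumr_ge0 => j' _.
    by rewrite !t1 !mul1r -expr2 sqr_ge0.
  lra.
apply: not_all_central => u0 x0 u0C.
(* Removes the [e]-component; the sign is plus because [<e,e> = -1]. *)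
pose u := u0 + ip u0 e *: e.
have uC : (u <= C)%MS by rewrite addmx_sub // scalemx_sub // e_commutator.
have bu x : br u x = br u0 x by rewrite brDl // brZl // br_el scaler0 addr0.
have ue : ip u e = 0 by rewrite ipDl ipZl ip_ee em mulrN1 subrr.
rewrite -bu; have [->|un0] := eqVneq u 0; first by rewrite br0l.
have uu : 0 < ip u u.
  by apply: (timelike_orthogonal symG lor (x := e)); rewrite ?ip_ee ?em ?ltrN10 // ipC.
have sq j : ip (br u (g j)) (br u (g j)) = - ip (br u (g j)) e ^+ 2.
  by rewrite {1 2}br_comm // ipZl ipZr ip_ee em; ring.
have := ricE u u; rewrite (ric_fcat_comm fr _ _ (fun=> e_commutator)) !big_ord1 br_er ip0l mulr0 add0r.
have -> : \sum_j -1 * t j * ip (br e (g j)) u * ip (br e (g j)) u = 0.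
  by apply: big1 => j _; rewrite br_el ip0l mulr0.
set A := \sum_j t j * _; set D := \sum_j _ => E.
have A_le0 : A = - \sum_j ip (br u (g j)) e ^+ 2.
  by rewrite /A -sumrN; apply: eq_bigr => j _; rewrite sq t1 mul1r.
have D_ge0 : 0 <= D.
  apply: sumr_ge0 => j _; apply: sumr_ge0 => j' _.
  by rewrite !t1 !mul1r -expr2 sqr_ge0.
have A_ge0 : 0 <= \sum_j ip (br u (g j)) e ^+ 2 by apply: sumr_ge0 => j _; apply: sqr_ge0.
have lu : lam * ip u u <= 0 by rewrite mulr_le0_ge0 // ltW.
have /eqP : \sum_j ip (br u (g j)) e ^+ 2 = 0 by lra.
rewrite psumr_eq0 => [/allP h|j _]; last exact: sqr_ge0.
apply: (frame_central fr) => [i|j]; first exact: br_er.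
have := h j (mem_index_enum _); rewrite /= sqrf_eq0 => /eqP h0.
by rewrite br_comm // h0 mulr0 scale0r.
Qed.

(* A nonzero [z0] would be null. In a frame with [z0 = f0 + f1] one gets
   [[z0,x] = c <z0,x> e] and [lam = c^2 / 2], while the sum of [ric(g_j,g_j)] over
   the rest of the frame is at most [-2 c^2]; so [c = 0] and [z0] is central. *)
Lemma commutator_nondegenerate z0 : (z0 <= C)%MS -> ip z0 e = 0 ->
  (forall w, (w <= C)%MS -> ip w z0 = 0) -> z0 = 0.
Proof.
move=> z0C z0e z0p; apply/eqP; apply: contraT => z00; exfalso.
have ee1 : ip e e = 1 by rewrite ip_ee center_spacelike.
have z0z0 : ip z0 z0 = 0 by exact: z0p.
have [y0 zy0] : exists y0, ip z0 y0 != 0.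
  have : z0 *m G != 0 by apply: contraNneq z00 => h; rewrite -(mulmxK unitG z0) h mul0mx.
  by case/rV0Pn => k hk; exists (ebase R k); rewrite ip_ebase.
(* Construction of a null vector [y3] orthogonal to [e] with [<z0,y3> = 2]; half the difference and
   half the sum of [z0] and [y3] are then a timelike and a spacelike unit vector. *)
pose y2 := (2 / ip z0 y0) *: (y0 - ip y0 e *: e).
have zy2 : ip z0 y2 = 2 by rewrite ipZr ipBr ipZr z0e mulr0 subr0 divfK.
have y2e : ip y2 e = 0 by rewrite ipZl ipBl ipZl ee1 mulr1 subrr mulr0.
pose y3 := y2 - (ip y2 y2 / 4) *: z0.
have zy3 : ip z0 y3 = 2 by rewrite ipBr ipZr z0z0 mulr0 subr0.
have y3e : ip y3 e = 0 by rewrite ipBl ipZl y2e z0e mulr0 subr0.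
have y3y3 : ip y3 y3 = 0.
  have -> : ip y3 y3 = ip y2 y3 - ip y2 y2 / 4 * ip z0 y3 by rewrite -ipZl -ipBl.
  by rewrite zy3 ipBr ipZr (ipC y2 z0) zy2; field.
have y3z : ip y3 z0 = 2 by rewrite ipC.
clearbody y3.
pose f0 := 2^-1 *: (z0 - y3); pose f1 := 2^-1 *: (z0 + y3).
have zE : z0 = f0 + f1.
  rewrite /f0 /f1 -scalerDr addrACA addNr addr0 -mulr2n -scaler_nat scalerA.
  by rewrite mulVf ?scale1r ?pnatr_eq0.
have f00 : ip f0 f0 = -1.
  by rewrite ipZl ipZr ipBl !ipBr z0z0 zy3 y3z y3y3; field.
have f11 : ip f1 f1 = 1.
  by rewrite ipZl ipZr ipDl !ipDr z0z0 zy3 y3z y3y3; field.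
have f01 : ip f0 f1 = 0.
  by rewrite ipZl ipZr ipBl !ipDr z0z0 zy3 y3z y3y3; field.
have f0e : ip f0 e = 0 by rewrite ipZl ipBl z0e y3e subrr mulr0.
have f1e : ip f1 e = 0 by rewrite ipZl ipDl z0e y3e addr0 mulr0.
clearbody f0 f1.
pose f (i : 'I_1 + bool) := match i with inl _ => e | inr true => f1 | inr false => f0 end.
pose s (i : 'I_1 + bool) : R := match i with inl _ => 1 | inr true => 1 | inr false => -1 end.
have [||m [g [t fr]]] := @frame_extension _ _ _ symG _ f s unitG.
- by move=> [i|[]]; [left|left|right].
- move=> [i|[]] [j|[]]; rewrite /= ?ord1 ?eqxx //=; by rewrite ipC.
have {}fr : frame G (fcat f g) (scat s t) by [].
have t1 j : t j = 1.
  by apply: (timelike_sign fr (x := f0)); rewrite ?f00 ?(frame_fg fr (inr false)) // ltrN10.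
have ge j : ip (g j) e = 0 by rewrite ipC (frame_fg fr (inl ord0)).
have gz j : ip (g j) z0 = 0.
  by rewrite zE ipDr !(ipC (g j)) (frame_fg fr (inr false)) (frame_fg fr (inr true)) addr0.
pose th x := ip (br z0 x) e.
have brz x : br z0 x = th x *: e by rewrite br_comm // center_spacelike mul1r.
have br0 x : br f0 x = th x *: e - br f1 x.
  by rewrite -brz {1}zE brDl // addrK.
have th01 : th f0 = - th f1.
  by apply/eqP; rewrite -addr_eq0 /th -ipDl -brDr // -zE br_self // ip0l.
have perp x y : ip (br x y) z0 = 0 by apply: z0p; apply: br_commutator.
(* In [ric(z0,z0) = 0] the contributions of [f0] and [f1] cancel, leaving the sum of the squares
   [th (g j) ^+ 2]. *)
have thg j : th (g j) = 0.
  have := ricE z0 z0; rewrite (ric_fcat_perp fr) // z0z0 mulr0 big_sumType big_ord1 big_bool /=.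
  rewrite br_er ip0l mulr0 add0r !brz !ipZl !ipZr ee1 th01.
  under eq_bigr => i _ do rewrite t1 mul1r brz ipZl ipZr ee1 mulr1 -expr2.
  move=> h; have /eqP : \sum_i th (g i) ^+ 2 = 0 by lra.
  rewrite psumr_eq0 => [/allP/(_ j (mem_index_enum _))|i _]; last exact: sqr_ge0.
  by rewrite /= sqrf_eq0 => /eqP.
pose c := th f1.
have b01 : br f0 f1 = c *: e by rewrite br0 br_self // subr0.
have b10 : br f1 f0 = - (c *: e) by rewrite brC // b01.
have b0g j : br f0 (g j) = - br f1 (g j) by rewrite br0 thg scale0r sub0r.
have lamE : lam = c ^+ 2 / 2.
  have := ricE z0 f1; rewrite (ric_fcat_perp fr) // big_sumType big_ord1 big_bool /=.
  rewrite br_er ip0l mulr0 add0r br_self // ip0r mulr0 add0r b10 brz th01 -/c.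
  rewrite [X in _ + X]big1 ?addr0 => [|j _]; last by rewrite brz thg scale0r ip0l mulr0.
  rewrite ipNr !ipZl !ipZr ee1 {1}zE ipDl f01 f11; lra.
pose Phi := \sum_j \sum_j' ip (br (g j) (g j')) e ^+ 2.
have PhiE : Phi = 4 * c ^+ 2.
  have := ricE e e; rewrite (ric_fcat fr) !big_sumType !big_ord1 !big_bool /=.
  rewrite !big_sumType !big_ord1 !big_bool /=.
  rewrite !br_el !br_er !(br_self lie) b01 b10 !ip0l.
  have -> : \sum_j t j * ip (br e (g j)) (br e (g j)) = 0.
    by apply: big1 => j _; rewrite br_el ip0l mulr0.
  have -> : \sum_j 1 * t j * ip (br e (g j)) e * ip (br e (g j)) e = 0.
    by apply: big1 => j _; rewrite br_el ip0l mulr0.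
  have -> : \sum_j -1 * t j * ip (br f0 (g j)) e * ip (br f0 (g j)) e =
       - \sum_j 1 * t j * ip (br f1 (g j)) e * ip (br f1 (g j)) e.
    by rewrite -sumrN; apply: eq_bigr => j _; rewrite b0g ipNl; ring.
  have -> : \sum_j \sum_j' t j * t j' * ip (br (g j) (g j')) e * ip (br (g j) (g j')) e = Phi.
    by apply: eq_bigr => j _; apply: eq_bigr => j' _; rewrite !t1; ring.
  rewrite ipNl ipZl ee1 lamE; lra.
pose P j l k := ip (br (g j) (g l)) (g k) ^+ 2.
have ricg j : - 2^-1 * \sum_l (ip (br (g j) (g l)) e ^+ 2 + \sum_k P j l k)
              + 4^-1 * \sum_l \sum_k P l k j = lam.
  have := ricE (g j) (g j); rewrite (ric_fcat fr) !big_sumType !big_ord1 !big_bool /=.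
  rewrite !big_sumType !big_ord1 !big_bool /=.
  rewrite !br_el !br_er !(br_self lie) b01 b10 !ip0l ipNl !ipZl !(ipC e) !ge.
  have -> : \sum_k 1 * t k * ip (br e (g k)) (g j) * ip (br e (g k)) (g j) = 0.
    by apply: big1 => k _; rewrite br_el ip0l mulr0.
  have -> : \sum_k -1 * t k * ip (br f0 (g k)) (g j) * ip (br f0 (g k)) (g j) =
       - \sum_k 1 * t k * ip (br f1 (g k)) (g j) * ip (br f1 (g k)) (g j).
    by rewrite -sumrN; apply: eq_bigr => k _; rewrite b0g ipNl; ring.
  have -> : \sum_l \sum_k t l * t k * ip (br (g l) (g k)) (g j) * ip (br (g l) (g k)) (g j)
      = \sum_l \sum_k P l k j.
    by apply: eq_bigr => l _; apply: eq_bigr => k _; rewrite !t1 /P; ring.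
  have -> : \sum_l t l * ip (br (g j) (g l)) (br (g j) (g l)) =
      \sum_l (ip (br (g j) (g l)) e ^+ 2 + \sum_k P j l k).
    apply: eq_bigr => l _; rewrite t1 mul1r (frame_ipE fr) big_sumType big_ord1 big_bool /=.
    have -> : ip (br (g j) (g l)) f0 = - ip (br (g j) (g l)) f1.
      by apply/eqP; rewrite -addr_eq0 -ipDr -zE perp.
    have -> : \sum_k t k * ip (br (g j) (g l)) (g k) * ip (br (g j) (g l)) (g k) = \sum_k P j l k.
      by apply: eq_bigr => k _; rewrite t1 /P; ring.
    by ring.
  rewrite (brC lie (g j) f0) (brC lie (g j) f1) b0g !ipNl !ipNr (frame_g fr) eqxx t1.
  lra.
pose Psi := \sum_j \sum_l \sum_k P j l k.
(* Each [<[g_j,g_l],g_k>^2] enters the sum once with weight [-1/2] and once with weight [1/4]. *)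
have : \sum_(j < m) lam = - 2^-1 * Phi - 4^-1 * Psi.
  have -> : \sum_(j < m) lam = \sum_j (- 2^-1 * \sum_l (ip (br (g j) (g l)) e ^+ 2 +
      \sum_k P j l k) + 4^-1 * \sum_l \sum_k P l k j) by apply: eq_bigr => j _; rewrite ricg.
  rewrite big_split /= -!mulr_sumr.
  have -> : \sum_j \sum_l \sum_k P l k j = Psi.
    rewrite /Psi exchange_big; apply: eq_bigr => l _ /=.
    by rewrite exchange_big.
  have -> : \sum_j \sum_l (ip (br (g j) (g l)) e ^+ 2 + \sum_k P j l k) =
      Phi + Psi.
    by rewrite /Phi /Psi -big_split; apply: eq_bigr => j _; rewrite big_split.
  lra.
have : 0 <= Psi.
  by do 3 (apply: sumr_ge0 => ? _); apply: sqr_ge0.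
have : 0 <= \sum_(j < m) lam by apply: sumr_ge0 => _ _; rewrite lamE divr_ge0 ?sqr_ge0.
move=> h1 h2 h3.
have c0 : c = 0.
  apply/eqP; rewrite -sqrf_eq0 eq_le sqr_ge0 andbT. by lra.
have zc x : br z0 x = 0.
  apply: (frame_central fr) => [[i|[]]|j]; rewrite ?br_er //= brz ?th01 -/c ?c0 ?oppr0 ?thg scale0r //.
by case/eqP: z00; rewrite (central_e zc) z0e mulr0 scale0r.
Qed.

Lemma ip_ee1 : ip e e = 1.
Proof. by rewrite ip_ee center_spacelike. Qed.

(** [B], the part of [C] orthogonal to [e], is nondegenerate by [commutator_nondegenerate]; an
    orthonormal basis of it together with [e] spans [C], and the extension to a frame spans the
    complement of [C]. *)
Lemma adapted_frame : exists k (z : 'I_k -> vec) (s : 'I_k -> R) m (x : 'I_m -> vec) (t : 'I_m -> R),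
  let f (i : 'I_1 + 'I_k) := match i with inl _ => e | inr k => z k end in
  let sf (i : 'I_1 + 'I_k) : R := match i with inl _ => 1 | inr k => s k end in
  [/\ frame G (fcat f x) (scat sf t), forall i, (f i <= C)%MS &
      forall w j, (w <= C)%MS -> ip w (x j) = 0].
Proof.
pose B := (C :&: kermx (G *m e^T))%MS.
have BE w : (w <= B)%MS = (w <= C)%MS && (ip w e == 0).
  rewrite sub_capmx; congr (_ && _); apply/sub_kermxP/eqP; rewrite mulmxA ip_mx.
    by move/matrixP/(_ 0 0); rewrite !mxE mulr1n.
  by move=> ->; apply/matrixP => i j; rewrite !mxE mul0rn.
have proj w : (w <= C)%MS -> (w - ip w e *: e <= B)%MS.
  move=> wC; rewrite BE ipBl ipZl ip_ee1 mulr1 subrr eqxx andbT.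
  by rewrite addmx_sub // -scaleNr scalemx_sub // e_commutator.
have nondeg w : (w <= B)%MS -> (forall y, (y <= B)%MS -> ip w y = 0) -> w = 0.
  rewrite BE => /andP[wC /eqP we] h; apply: commutator_nondegenerate => // v vC.
  by have := h _ (proj v vC); rewrite ipBr ipZr we mulr0 subr0 ipC.
have [k [z [s [zB s1 zz zspan]]]] := orthonormal_basis_sub symG nondeg.
have ze i : ip (z i) e = 0 by have := zB i; rewrite BE => /andP[_ /eqP].
pose f (i : 'I_1 + 'I_k) := match i with inl _ => e | inr k => z k end.
pose sf (i : 'I_1 + 'I_k) : R := match i with inl _ => 1 | inr k => s k end.
have [||m [x [t fr]]] := @frame_extension _ _ _ symG _ f sf unitG.
- by move=> [i|i] /=; [left | apply: s1].
- move=> [i|i] [j|j] /=.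
  + by rewrite !ord1 eqxx ip_ee1.
  + by rewrite ipC ze.
  + by rewrite ze.
  + by rewrite zz.
exists k, z, s, m, x, t; split=> //.
- by move=> [i|i] /=; [apply: e_commutator | have := zB i; rewrite BE => /andP[]].
have {}fr : frame G (fcat f x) (scat sf t) by [].
move=> w j wC; rewrite -(subrK (ip w e *: e) w) ipDl ipZl (frame_fg fr (inl ord0)) mulr0 addr0.
rewrite (zspan _ (proj w wC)) ip_suml big1 // => i _.
by rewrite ipZl (frame_fg fr (inr i)) mulr0.
Qed.

(* The curvatures of the timelike [g_j0], of all [g_j] and of all [f_i], summed,
   give [lam = 0] and [[f_i,g_j] = 0], so that [C] is central. *)
Lemma commutator_not_spacelike (I J : finType) (f : I -> vec) (g : J -> vec) (t : J -> R) :
  frame G (fcat f g) (scat (fun=> 1) t) -> (forall i, (f i <= C)%MS) ->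
  (forall w j, (w <= C)%MS -> ip w (g j) = 0) -> False.
Proof.
move=> fr fC Cg.
have ipC_E w w' : (w <= C)%MS -> ip w w' = \sum_i ip w (f i) * ip w' (f i).
  move=> wC; rewrite (frame_ipE fr) [X in _ + X]big1 ?addr0 => [|j _].
    by apply: eq_bigr => i _; rewrite mul1r.
  by rewrite Cg // mulr0 mul0r.
have posC w : (w <= C)%MS -> 0 <= ip w w.
  by move=> wC; rewrite ipC_E // sumr_ge0 // => i _; rewrite -expr2 sqr_ge0.
have defC w : (w <= C)%MS -> ip w w = 0 -> w = 0.
  move=> wC; rewrite ipC_E // => /eqP; rewrite psumr_eq0 => [/allP h|i _]; last first.
    by rewrite -expr2 sqr_ge0.
  rewrite [w](frame_spanE fr) !big1 ?addr0 // => i _; last first.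
    by have := h i (mem_index_enum _); rewrite /= mulf_eq0 orbb => /eqP ->; rewrite mulr0 scale0r.
  by rewrite Cg // mulr0 scale0r.
have [x0 x0lt] := exists_timelike lor.
have [j0 tj0] : exists j0, t j0 = -1.
  have [/existsP [j /eqP tj]|/existsPn h] := boolP [exists j, t j == -1]; first by exists j.
  have : 0 <= ip x0 x0; last by rewrite leNgt x0lt.
  rewrite (frame_ipE fr) addr_ge0 // sumr_ge0 // => i _; first by rewrite mul1r -expr2 sqr_ge0.
  case: (frame_sign_t fr i) (h i) => ->; last by rewrite eqxx.
  by rewrite mul1r -expr2 sqr_ge0.
have t1 j : j != j0 -> t j = 1.
  move=> jj0; have gj0 : ip (g j0) (g j0) < 0 by rewrite (frame_g fr) eqxx tj0 ltrN10.
  have gg : ip (g j0) (g j) = 0 by rewrite (frame_g fr) eq_sym (negPf jj0).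
  have := timelike_orthogonal symG lor gj0 gg; rewrite (frame_g fr) eqxx.
  case: (frame_sign_t fr j) => // tj; rewrite tj => h.
  have : 0 < -1 :> R; last by lra.
  apply: h; apply/eqP => g0; have := frame_g fr j j; rewrite g0 ip0l eqxx tj; lra.
pose a j := \sum_l t l * ip (br (g j) (g l)) (br (g j) (g l)).
pose b j := \sum_i ip (br (g j) (f i)) (br (g j) (f i)).
have b_ge0 j : 0 <= b j by apply: sumr_ge0 => i _; apply/posC/br_commutator.
have Eg j : - 2^-1 * (b j + a j) = lam * t j.
  have := ricE (g j) (g j); rewrite (ric_fcat_perp fr) => [|? ?]; last by rewrite Cg ?br_commutator.
  rewrite (frame_g fr) eqxx => <-; congr (_ * (_ + _)).
  by apply: eq_bigr => i _; rewrite mul1r.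
have a0 : 0 <= a j0.
  rewrite /a (bigD1 j0) //= br_self // ip0l mulr0 add0r sumr_ge0 // => l lj.
  by rewrite t1 // mul1r; apply/posC/br_commutator.
have tt j : t j * t j = 1 by case: (frame_sign_t fr j) => ->; rewrite ?mulrNN mulr1.
pose T := \sum_j t j * a j.
pose S := \sum_j t j * b j.
have sg : - 2^-1 * (S + T) = lam * #|J|%:R.
  transitivity (\sum_(j : J) lam); last by rewrite sumr_const mulr_natr.
  rewrite /S /T -big_split mulr_sumr; apply: eq_bigr => j _ /=.
  by rewrite -mulrDr mulrCA Eg mulrCA tt mulr1.
(* By Parseval in [C], the sums over [i] of [X i] and [Y i] are both [S] and that of [Z i] is [T],
   so the left side reduces to [T / 4]. *)
have sf : - 2^-1 * S + 4^-1 * (2 * S + T) = lam * #|I|%:R.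
  pose X i := \sum_j t j * ip (br (g j) (f i)) (br (g j) (f i)).
  pose Y i := \sum_i' \sum_j t j * ip (br (g j) (f i')) (f i) ^+ 2.
  pose Z i := \sum_j \sum_j' t j * t j' * ip (br (g j) (g j')) (f i) ^+ 2.
  have Ef i : - 2^-1 * X i + 4^-1 * (2 * Y i + Z i) = lam.
    have := ricE (f i) (f i); rewrite (ric_fcat_comm fr _ _ fC) (frame_f fr) eqxx mulr1 => <-.
    congr (_ * _ + _ * (_ * _ + _)).
    - rewrite big1 ?add0r => [|i' _]; last by rewrite br_comm_comm // ip0l mulr0.
      by apply: eq_bigr => j _; rewrite (brC lie (f i)) ipNl ipNr opprK.
    - apply: eq_bigr => i' _; apply: eq_bigr => j _.
      by rewrite (brC lie (f i')) ipNl mul1r; ring.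
    - by apply: eq_bigr => j _; apply: eq_bigr => j' _; rewrite expr2 mulrA.
  have SX : \sum_i X i = S.
    by rewrite exchange_big; apply: eq_bigr => j _; rewrite /= mulr_sumr.
  have SY : \sum_i Y i = S.
    rewrite exchange_big -SX; apply: eq_bigr => i' _ /=.
    rewrite exchange_big; apply: eq_bigr => j _ /=.
    rewrite (ipC_E _ _ (br_commutator _ _)) mulr_sumr.
    by apply: eq_bigr => i _; rewrite expr2.
  have SZ : \sum_i Z i = T.
    rewrite exchange_big; apply: eq_bigr => j _ /=.
    rewrite exchange_big /a mulr_sumr; apply: eq_bigr => j' _ /=.
    rewrite (ipC_E _ _ (br_commutator _ _)) !mulr_sumr.
    by apply: eq_bigr => i _; rewrite expr2; ring.
  transitivity (\sum_(i : I) lam); last by rewrite sumr_const mulr_natr.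
  rewrite -{2}SY -SX -SZ !mulr_sumr -big_split mulr_sumr -big_split.
  by apply: eq_bigr => i _; rewrite -(Ef i).
have Sj0 : S = \sum_(j | j != j0) b j - b j0.
  rewrite /S (bigD1 j0) //= tj0 mulN1r addrC; congr (_ - _).
  by apply: eq_bigr => j jj; rewrite t1 // mul1r.
have bs_ge0 : 0 <= \sum_(j | j != j0) b j by apply: sumr_ge0.
have Ej0 := Eg j0; rewrite tj0 in Ej0.
have J_ge1 : 1 <= #|J|%:R :> R by rewrite ler1n; apply/card_gt0P; exists j0.
have bj0 := b_ge0 j0.
have lam_ge0 : 0 <= lam by lra.
have lJ : lam <= lam * #|J|%:R by rewrite ler_peMr.
have lI : 0 <= lam * #|I|%:R by rewrite mulr_ge0 // ler0n.
have I_ge1 : (0 < #|I|)%N.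
  rewrite lt0n; apply/eqP => /eqP/pred0P I0.
  have e0 : e = 0.
    apply: defC (e_commutator) _; rewrite ipC_E ?e_commutator // big1 // => i.
    by have := I0 i; rewrite inE.
  by have := e_neq0; rewrite e0 eqxx.
have lI' : lam <= lam * #|I|%:R by rewrite ler_peMr // ler1n.
(* From [sg] and [sf], [- S = 2 lam #|J| + 4 lam #|I|], while [- S <= b j0 <= 2 lam]; both index
   types are nonempty. *)
have lam0 : lam = 0 by lra.
have b0 j : b j = 0.
  have [->|jj] := eqVneq j j0; first by lra.
  have /eqP : \sum_(j | j != j0) b j = 0 by rewrite lam0 !mul0r in sg sf Ej0; lra.
  by rewrite psumr_eq0 // => /allP/(_ j (mem_index_enum _)); rewrite jj /= => /eqP.
have fc i x : br (f i) x = 0.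
  apply: (frame_central fr) => [i'|j]; first exact: br_comm_comm.
  rewrite brC // (defC (br (g j) (f i))) ?br_commutator ?oppr0 //.
  have /eqP := b0 j; rewrite psumr_eq0 => [/allP/(_ i (mem_index_enum _))/eqP //|i' _].
  exact/posC/br_commutator.
apply: not_all_central => u x uC.
rewrite [u](frame_spanE fr) (brDl lie) !(br_suml lie).
rewrite [X in X + _]big1 => [|i _]; last by rewrite brZl // fc scaler0.
by rewrite add0r big1 // => j _; rewrite Cg // mulr0 scale0r br0l.
Qed.

Lemma frame_eq_sign (I : finType) (f : I -> vec) (s s' : I -> R) :
  s =1 s' -> frame G f s -> frame G f s'.
Proof.
move=> ss [h1 h2 h3]; split=> [i|i j|x]; first by rewrite -ss.
  by rewrite h2 ss.
by rewrite {1}[x]h3; apply: eq_bigr => i _; rewrite ss.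
Qed.

(** * Spectral frame on the complement of the derived algebra, and the standard form *)

Definition om u w := ip (br u w) e.

Lemma brC_om u x : (u <= C)%MS -> br u x = om u x *: e.
Proof. by move=> uC; rewrite br_comm // center_spacelike mul1r. Qed.

Lemma sum_ip_rows p (X : 'M[R]_(p, n)) w :
  w *m (G *m X^T) *m X = \sum_j ip w (row j X) *: row j X.
Proof.
rewrite mulmx_sum_row; apply: eq_bigr => j _; congr (_ *: _).
rewrite /ip mulmxA [LHS]mxE [RHS]mxE; apply: eq_bigr => i _.
by congr (_ * _); rewrite !mxE.
Qed.

(** [W^T *m diag_mx S *m W] is the Gram matrix of the images of the [x_a] in [C]. The complement of
    [C] is Euclidean because [C] contains a timelike [z k0], so the orthogonal matrix [O]
    diagonalising this Gram matrix carries [x] to another orthonormal basis [v]. *)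
Lemma diagonal_frame : exists k (z : 'I_k -> vec) (s : 'I_k -> R) m (v y : 'I_m -> vec) (mu : 'I_m -> R),
  let f (i : 'I_1 + 'I_k) := match i with inl _ => e | inr k => z k end in
  let sf (i : 'I_1 + 'I_k) : R := match i with inl _ => 1 | inr k => s k end in
  [/\ [/\ frame G (fcat f v) (scat sf (fun=> 1)), forall i, (f i <= C)%MS,
          forall w j, (w <= C)%MS -> ip w (v j) = 0 & exists k0, s k0 = -1],
      forall a, (y a <= C)%MS /\ ip (y a) e = 0,
      forall a b, ip (y a) (y b) = if a == b then mu a else 0,
      forall u a, (u <= C)%MS -> om u (v a) = ip u (y a) &
      forall a, \sum_k s k * om (z k) (v a) ^+ 2 = mu a].
Proof.
have [k [z [s [m [x [t /= [fr fC Cx]]]]]]] := adapted_frame.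
set f := fun i : 'I_1 + 'I_k => _ in fr fC *.
set sf := fun i : 'I_1 + 'I_k => _ in fr *.
have [k0 sk0] : exists k0, s k0 = -1.
  have [/existsP [j /eqP tj]|/existsPn h] := boolP [exists j, s j == -1]; first by exists j.
  exfalso; apply: (@commutator_not_spacelike _ _ f x t) => //.
  apply: (frame_eq_sign _ fr) => -[[i|i]|i] //=.
  have [/(_ (inl (inr i))) /= si _ _] := fr.
  by case: si (h i) => -> //; rewrite eqxx.
have zk0 : ip (z k0) (z k0) < 0 by rewrite (frame_f fr (inr k0) (inr k0)) eqxx /sf sk0 ltrN10.
have t1 j : t j = 1.
  by apply: (timelike_sign fr zk0) ; apply: (frame_fg fr (inr k0)).
pose X : 'M[R]_(m, n) := \matrix_j x j.
pose W : 'M[R]_(k, m) := \matrix_(i, j) om (z i) (x j).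
pose S : 'rV[R]_k := \row_i s i.
have [|O [d [OO Od]]] := @symmetric_diagonalization R _ (W^T *m diag_mx S *m W).
  by rewrite !trmx_mul trmxK tr_diag_mx mulmxA.
have O'O : O^T *m O = 1%:M by apply: mulmx1C.
pose v a := row a (O *m X).
have vE a : v a = \sum_j O a j *: x j.
  by rewrite /v row_mul mulmx_sum_row; apply: eq_bigr => j _; rewrite rowK mxE.
have xx : X *m G *m X^T = 1%:M.
  by apply/matrixP => i j; rewrite -ip_row !rowK (frame_g fr) t1 mxE; case: eqP.
have omv w a : om w (v a) = \sum_j om w (x j) * O a j.
  rewrite /om vE br_sumr // ip_suml; apply: eq_bigr => j _.
  by rewrite brZr // ipZl mulrC.
have omW i a : om (z i) (v a) = (W *m O^T) i a.
  by rewrite omv mxE; apply: eq_bigr => j _; rewrite !mxE.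
have dE a b : \sum_i s i * om (z i) (v a) * om (z i) (v b) = if a == b then d 0 a else 0.
  have -> : (if a == b then d 0 a else 0) = (diag_mx d) a b.
    by rewrite mxE; case: eqP => // _; rewrite mulr1n.
  have -> : diag_mx d = (W *m O^T)^T *m (diag_mx S *m (W *m O^T)).
    by rewrite -Od trmx_mul trmxK !mulmxA.
  rewrite mxE; apply: eq_bigr => i _; rewrite mul_diag_mx !omW [(_^T) _ _]mxE.
  by rewrite [(\matrix_(_, _) _) _ _]mxE [S _ _]mxE; ring.
have Cv w j : (w <= C)%MS -> ip w (v j) = 0.
  move=> wC; rewrite vE ip_sumr big1 // => i _; by rewrite ipZr Cx // mulr0.
pose y a := \sum_i (s i * om (z i) (v a)) *: z i.
have yC a : (y a <= C)%MS.
  by apply: summx_sub => i _; rewrite scalemx_sub // (fC (inr i)).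
have omy u a : (u <= C)%MS -> om u (v a) = ip u (y a).
  move=> uC; rewrite {1}[u](frame_spanE fr) [X in _ + X]big1 ?addr0 => [|j _]; last first.
    by rewrite Cx // mulr0 scale0r.
  rewrite big_sumType big_ord1 /= /om brDl // br_suml // ipDl ip_suml brZl // br_el scaler0.
  rewrite ip0l add0r ip_sumr; apply: eq_bigr => i _.
  by rewrite brZl // ipZl ipZr /om; ring.
exists k, z, s, m, v, y, (fun a => d 0 a); split=> //.
- split=> //; last by exists k0.
  have [h1 h2 h3] := fr; split=> [[i|j] /=|[i|a] [j|b] /=|w].
  + exact: (h1 (inl i)).
  + by left.
  + exact: (h2 (inl i) (inl j)).
  + by rewrite Cv.
  + by rewrite ipC Cv.
    rewrite /v ip_row trmx_mul !mulmxA -2!(mulmxA O) xx mulmx1 OO mxE.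
    by rewrite -[inr a == _]/(a == b); case: eqP.
  rewrite {1}[w]h3 !big_sumType /=; congr (_ + _).
  transitivity (\sum_j ip w (row j X) *: row j X).
    by apply: eq_bigr => j _; rewrite t1 mul1r rowK.
  rewrite -sum_ip_rows -[X in _ *m X]mul1mx -O'O -!mulmxA (mulmxA X^T) -trmx_mul.
  rewrite (mulmxA G) mulmxA sum_ip_rows; apply: eq_bigr => j _.
  by rewrite mul1r.
- move=> a; split=> //; rewrite ip_suml big1 // => i _.
  by rewrite ipZl (frame_f fr (inr i) (inl ord0)) mulr0.
- move=> a b; rewrite ip_suml -dE; apply: eq_bigr => i _.
  by rewrite ipZl -omy // (fC (inr i)).
- move=> a; have := dE a a; rewrite eqxx => <-; apply: eq_bigr => i _; ring.
Qed.

(* The normal form common to both families: [mu b = 0] gives (i) and [0 < mu b]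
   gives (ii). *)
Definition standard_form (m : nat) (v y : 'I_m -> vec) (mu : 'I_m -> R) (o a b : 'I_m) (sg : R) :=
  [/\ [/\ a != o, b != o, a != b & forall c, [|| c == o, c == a | c == b]],
      [/\ sg = 1 \/ sg = -1, 0 < mu a, 0 <= mu b & mu o = - (mu a + mu b)],
      [/\ forall i j, ip (v i) (v j) = if i == j then 1 else 0,
          forall i j, ip (y i) (y j) = if i == j then mu i else 0,
          forall i j, ip (y i) (v j) = 0 &
          forall i, ip (v i) e = 0 /\ ip (y i) e = 0],
      [/\ br (v o) (v a) = - sg *: y b, br (v o) (v b) = sg *: y a,
          br (v a) (v b) = - sg *: y o,
          forall i j, br (y i) (v j) = (if i == j then mu i else 0) *: e &
          forall i j, br (y i) (y j) = 0] &
      forall x, x = ip x e *: e + \sum_i ip x (v i) *: v i + \sum_i (ip x (y i) / mu i) *: y i].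

(** The Ricci equations on [y_k], [v_a], [e] and the mixed pairs [(v_b, y_a)] supply the hypotheses
    of [structure_constants], whose output is turned back into brackets by expanding in [e] and the
    [y_i]. *)
Theorem einstein_standard_form : lam = 0 /\
  exists m (v y : 'I_m -> vec) mu o a b sg, standard_form v y mu o a b sg.
Proof.
have [k [z [s [m [v [y [mu /= [[fr fC Cv [k0 sk0]] yC yy omy zmu]]]]]]]] := diagonal_frame.
set f := fun i : 'I_1 + 'I_k => _ in fr fC *.
set sf := fun i : 'I_1 + 'I_k => _ in fr *.
have vC w j : (w <= C)%MS -> ip (v j) w = 0 by move=> wC; rewrite ipC Cv.
have ev j : ip e (v j) = 0 by apply: Cv; apply: e_commutator.
have ze i : ip (z i) e = 0 by apply: (frame_f fr (inr i) (inl ord0)).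
(* Such a [w] commutes with [C] and with every [v_c], so it is central, and being orthogonal to [e]
   it vanishes. *)
have C0 w : (w <= C)%MS -> ip w e = 0 -> (forall c, ip w (y c) = 0) -> w = 0.
  move=> wC we wy; rewrite (central_e (v := w)) ?we ?mulr0 ?scale0r //.
  apply: (frame_central fr) => [i|j]; first exact: br_comm_comm wC (fC i).
  by rewrite brC_om // omy // wy scale0r.
have y_deg a : mu a = 0 -> y a = 0.
  move=> ma; have [yaC yae] := yC a; apply: C0 => // c.
  by rewrite yy ma; case: eqP.
have Cspan w : (w <= C)%MS -> w = ip w e *: e + \sum_i (ip w (y i) / mu i) *: y i.
  move=> wC; apply/eqP; rewrite -subr_eq0; apply/eqP; apply: C0.
  - rewrite addmx_sub // -scaleN1r scalemx_sub // addmx_sub ?scalemx_sub ?e_commutator //.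
    by apply: summx_sub => i _; rewrite scalemx_sub //; have [] := yC i.
  - rewrite ipBl ipDl ipZl ip_ee1 mulr1 ip_suml big1 ?addr0 ?subrr // => i _.
    by rewrite ipZl; have [_ ->] := yC i; rewrite mulr0.
  move=> c; rewrite ipBl ipDl ipZl ipC; have [_ yce] := yC c.
  rewrite (ipC e) yce mulr0 add0r ip_suml (bigD1 c) //= big1 ?addr0 => [|i ic]; last first.
    by rewrite ipZl yy (negPf ic) mulr0.
  rewrite ipZl yy eqxx ipC; have [mc|mc] := eqVneq (mu c) 0; last by rewrite divfK // subrr.
  by rewrite (y_deg c mc) ip0r mc mulr0 subrr.
have Cip w w' : (w <= C)%MS -> ip w w' = ip w e * ip w' e + \sum_i ip w (y i) * ip w' (y i) / mu i.
  move=> wC; rewrite {1}(Cspan w wC) ipDl ipZl ip_suml (ipC e); congr (_ + _).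
  by apply: eq_bigr => i _; rewrite ipZl (ipC (y i)); ring.
pose t k a b := ip (br (v a) (v b)) (y k).
pose del a := \sum_b om (v a) (v b) ^+ 2.
have bryv i j : br (y i) (v j) = (if i == j then mu i else 0) *: e.
  have [yiC _] := yC i; by rewrite brC_om // omy // yy.
(* If no [mu i] were negative, expanding the timelike vector [z k0] in the [y i] would give a
   nonnegative square. *)
have [o mu_o] : exists o, mu o < 0.
  apply/existsP; apply: contraT => /existsPn h.
  have : ip (z k0) (z k0) < 0.
    by rewrite (frame_f fr (inr k0) (inr k0)) eqxx /sf sk0 ltrN10.
  rewrite Cip ?(fC (inr k0)) // ze mul0r add0r ltNge sumr_ge0 // => i _.
  by rewrite divr_ge0 // ?leNgt // -expr2 -leNgt sqr_ge0.
have mu_ge0 i : i != o -> 0 <= mu i.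
  move=> io; have yo : ip (y o) (y o) < 0 by rewrite yy eqxx.
  have [yi|yi] := eqVneq (y i) 0; first by have := yy i i; rewrite eqxx yi ip0l => <-.
  have := timelike_orthogonal symG lor yo _ yi; rewrite !yy eqxx eq_sym (negPf io) => h.
  by apply/ltW/h.
have anti k' a b : t k' a b = - t k' b a by rewrite /t brC // ipNl.
have tE i a b : t i a b = om (br (v a) (v b)) (v i) by rewrite omy // br_commutator.
have cyclic i a b : t i a b + t a b i + t b i a = 0.
  rewrite !tE /om -!ipDl; have := jacobi lie (v a) (v b) (v i).
  rewrite (brC lie (v a) (br _ _)) (brC lie (v b) (br _ _)) (brC lie (v i) (br _ _)).
  rewrite -!opprD => /eqP; rewrite oppr_eq0 => /eqP h.
  by rewrite -addrA [X in ip X e]addrC h ip0l.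
have t_deg k' a b : mu k' = 0 -> t k' a b = 0 by move=> mk; rewrite /t y_deg // ip0r.
have del_ge0 a : 0 <= del a by apply: sumr_ge0 => b _; apply: sqr_ge0.
have perp_v a x w : ip (br x w) (v a) = 0 by rewrite Cv // br_commutator.
have del_deg a : mu a != 0 -> del a = 0.
  move=> ma; apply: big1 => b _; have := ricE (v b) (y a).
  have [yaC yae] := yC a.
  rewrite (ric_fcat_perp fr) ?vC ?mulr0 // big1 ?add0r => [|i _]; last first.
    by rewrite (br_comm_comm yaC (fC i)) ip0r mulr0.
  rewrite (bigD1 a) //= big1 ?addr0 => [|c ca]; last by rewrite bryv eq_sym (negPf ca) scale0r ip0r mulr0.
  rewrite bryv eqxx ipZr mul1r => h.
  have /eqP : mu a * om (v b) (v a) = 0 by rewrite /om; lra.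
  rewrite mulf_eq0 (negPf ma) /= => /eqP; rewrite /om brC // ipNl => /eqP.
  by rewrite oppr_eq0 => /eqP ->; rewrite expr0n.
have E1 k' : \sum_a \sum_b t k' a b ^+ 2 = 4 * lam * mu k' + 2 * mu k' ^+ 2.
  have [ykC yke] := yC k'; have := ricE (y k') (y k'); rewrite (ric_fcat_comm fr _ _ fC).
  rewrite yy eqxx big1 ?add0r => [|i _]; last by rewrite (br_comm_comm ykC (fC i)) ip0r mulr0.
  rewrite (bigD1 k') //= big1 ?addr0 => [|c ca]; last by rewrite bryv eq_sym (negPf ca) scale0r ip0r mulr0.
  rewrite [X in 2 * X]big1 => [|i _]; last first.
    by apply: big1 => j _; rewrite (brC_om _ (fC i)) ipZl (ipC e) yke !mulr0.
  rewrite bryv eqxx ipZl ipZr ip_ee1.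
  have -> : \sum_j \sum_j' 1 * 1 * ip (br (v j) (v j')) (y k') * ip (br (v j) (v j')) (y k') =
      \sum_a \sum_b t k' a b ^+ 2.
    by apply: eq_bigr => a _; apply: eq_bigr => b _; rewrite /t; ring.
  by rewrite expr2; lra.
have E2 a : - (\sum_b \sum_k' t k' a b ^+ 2 / mu k') = 2 * lam + mu a + del a.
  have := ricE (v a) (v a); rewrite (ric_fcat_perp fr) // (frame_g fr) eqxx.
  rewrite big_sumType big_ord1 /= br_er ip0l mulr0 add0r.
  have -> : \sum_i s i * ip (br (v a) (z i)) (br (v a) (z i)) = mu a.
    rewrite -zmu; apply: eq_bigr => i _.
    by rewrite brC // ipNl ipNr opprK brC_om ?(fC (inr i)) // ipZl ipZr ip_ee1; ring.
  have -> : \sum_j 1 * ip (br (v a) (v j)) (br (v a) (v j)) =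
      del a + \sum_b \sum_k' t k' a b ^+ 2 / mu k'.
    rewrite -big_split; apply: eq_bigr => b _ /=.
    by rewrite mul1r Cip ?br_commutator.
  lra.
have E3 : \sum_a del a + 2 * \sum_a mu a = 4 * lam.
  have := ricE e e; rewrite (ric_fcat_comm fr _ _ fC) ip_ee1.
  rewrite big1 ?add0r => [|i _]; last by rewrite br_el ip0l mulr0.
  rewrite big1 ?add0r => [|i _]; last by rewrite br_el ip0l mulr0.
  rewrite big_sumType big_ord1 /= [X in 2 * (X + _)]big1 ?add0r => [|j _]; last first.
    by rewrite br_el ip0l mulr0.
  have -> : \sum_i \sum_j s i * 1 * ip (br (z i) (v j)) e * ip (br (z i) (v j)) e = \sum_a mu a.
    rewrite exchange_big; apply: eq_bigr => a _ /=; rewrite -zmu; apply: eq_bigr => i _.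
    by rewrite /om; ring.
  have -> : \sum_j \sum_j' 1 * 1 * ip (br (v j) (v j')) e * ip (br (v j) (v j')) e = \sum_a del a.
    by apply: eq_bigr => a _; apply: eq_bigr => b _; rewrite /om; ring.
  lra.
have [lam0 del0 _ _] := rigidity mu_o mu_ge0 anti t_deg del_ge0 del_deg E1 E2 E3.
have om0 a b : om (v a) (v b) = 0.
  have /eqP := del0 a; rewrite psumr_eq0 => [/allP/(_ b (mem_index_enum _))|i _]; last exact: sqr_ge0.
  by rewrite /= sqrf_eq0 => /eqP.
(* The combination [u] is shown to be central; it is orthogonal to [e], hence zero. *)
have nondeg (x : 'I_m -> R) : (forall a, mu a != 0 -> x a = 0) ->
    (forall k' b, \sum_a x a * t k' a b = 0) -> forall a, x a = 0.
  move=> x0 xt a; pose u := \sum_a x a *: v a.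
  have -> : x a = ip u (v a).
    rewrite ip_suml (bigD1 a) //= big1 ?addr0 => [|b ba].
      by rewrite ipZl (frame_g fr) eqxx mulr1.
    by rewrite ipZl (frame_g fr) (negPf ba) mulr0.
  have ue : ip u e = 0 by rewrite ip_suml big1 // => b _; rewrite ipZl ipC ev mulr0.
  rewrite (central_e (v := u)) ?ue ?mulr0 ?scale0r ?ip0l //.
  apply: (frame_central fr) => [[i|i]|b] /=; first exact: br_er.
    rewrite brC // brC_om ?(fC (inr i)) // /om /u br_sumr // ip_suml big1 ?scale0r ?oppr0 // => b _.
    rewrite brZr // ipZl -/(om _ _) omy ?(fC (inr i)) //.
    have [mb|mb] := eqVneq (mu b) 0; first by rewrite y_deg // ip0r mulr0.
    by rewrite x0 // mul0r.
  apply: C0; first exact: br_commutator.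
    rewrite /u br_suml // ip_suml big1 // => c _.
    by rewrite brZl // ipZl -/(om _ _) om0 mulr0.
  move=> c; rewrite /u br_suml // ip_suml -[RHS](xt c b); apply: eq_bigr => d _.
  by rewrite brZl // ipZl.
have [a [b [sg [[ao bo ab cov] sgE [ma mb moE] [tao tbo tob] [t1 t2 t3 t4 [t5 t6]]]]]] :=
  structure_constants mu_o mu_ge0 anti cyclic t_deg del_ge0 del_deg E1 E2 E3 nondeg.
split=> //; exists m, v, y, mu, o, a, b, sg.
have sum3 (F : 'I_m -> vec) : \sum_i F i = F o + (F a + F b).
  rewrite (bigD1 o) //= (bigD1 a) //= (bigD1 b) /= ?bo 1?eq_sym // big1 ?addr0 // => i.
  by case/andP=> /andP[io ia] ib; have := cov i; rewrite (negPf io) (negPf ia) (negPf ib).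
have brvv i j : br (v i) (v j) = t o i j / mu o *: y o + (t a i j / mu a *: y a + t b i j / mu b *: y b).
  rewrite (Cspan _ (br_commutator (v i) (v j))) -/(om _ _) om0 scale0r add0r sum3.
  by [].
have ma0 : mu a != 0 by rewrite gt_eqF.
have mo0 : mu o != 0 by rewrite lt_eqF.
split=> //.
- split=> // [i j|i j|i].
  + by rewrite (frame_g fr).
  + by rewrite Cv //; have [] := yC i.
  + by rewrite ipC ev; have [_ ->] := yC i.
- split=> // [|||i j].
  + rewrite brvv t1 t3 tbo !mul0r !scale0r !add0r.
    have [m0|m0] := eqVneq (mu b) 0; first by rewrite y_deg // !scaler0.
    by congr (_ *: _); field.
  + rewrite brvv t2 t4 tao !mul0r !scale0r add0r addr0.
    by congr (_ *: _); field.
  + rewrite brvv t5 t6 tob !mul0r !scale0r !addr0 moE.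
    have s0 : mu a + mu b != 0 by rewrite -oppr_eq0 -moE.
    by congr (_ *: _); field; rewrite s0.
  + by apply: br_comm_comm; [have [] := yC i | have [] := yC j].
move=> x.
pose w := \sum_i (sf i * ip x (f i)) *: f i.
have wC : (w <= C)%MS by apply: summx_sub => i _; rewrite scalemx_sub ?(fC i).
have xE : x = w + \sum_i ip x (v i) *: v i.
  rewrite {1}[x](frame_spanE fr); congr (_ + _).
  by apply: eq_bigr => i _; rewrite mul1r.
have wip u : (u <= C)%MS -> ip w u = ip x u.
  move=> uC; rewrite [in RHS]xE ipDl [X in _ + X](_ : _ = 0) ?addr0 //.
  by rewrite ip_suml big1 // => i _; rewrite ipZl vC // mulr0.
clearbody w.
rewrite {1}xE {1}(Cspan w wC) (wip e e_commutator) addrAC; congr (_ + _).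
by apply: eq_bigr => i _; rewrite wip //; have [] := yC i.
Qed.
End Einstein.

(** * Identification of the two families *)

(** Independence comes from the invertible diagonal Gram matrix, fullness from [span].
    Natural-number indices allow checking by finite case analysis while [n] is still unknown. *)
Lemma orthogonal_basis_dim (R : realType) (n N : nat) (G : 'M[R]_n) (l : seq 'rV[R]_n) (d : nat -> R) :
  (forall i, (i < N)%N -> d i != 0) ->
  (forall i j, (i < N)%N -> (j < N)%N -> ip G l`_i l`_j = if i == j then d i else 0) ->
  (forall x, exists c : nat -> R, x = \sum_(i < N) c i *: l`_i) -> n = N.
Proof.
move=> d0 ort span; pose A : 'M[R]_(N, n) := \matrix_(i < N) l`_i.
have Afree : row_free A.
  apply/row_freeP; exists (G *m A^T *m diag_mx (\row_(i < N) (d i)^-1)).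
  apply/matrixP => i j; rewrite !mulmxA mul_mx_diag mxE -ip_row !rowK ort // !mxE.
  by rewrite -val_eqE; case: eqP => [<-|]; rewrite ?mulfV ?d0 ?mul0r.
have Afull : row_full A.
  rewrite -sub1mx; apply/row_subP => i; have [c ->] := span (row i 1%:M).
  by apply: summx_sub => j _; rewrite scalemx_sub // -[l`_j](rowK (fun i : 'I_N => l`_i)) row_sub.
by move: Afree Afull; rewrite /row_free /row_full => /eqP -> /eqP.
Qed.

Lemma basis_of_list (R : realType) (n N : nat) (br : 'rV[R]_n -> 'rV[R]_n -> 'rV[R]_n)
    (G : 'M[R]_n) (l : seq 'rV[R]_n) c g : n = N ->
  (forall x, exists c : nat -> R, x = \sum_(i < N) c i *: l`_i) ->
  (forall i j, (i < N)%N -> (j < N)%N ->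
    br l`_i l`_j = \sum_(k < N) c i.+1 j.+1 k.+1 *: l`_k) ->
  (forall i j, (i < N)%N -> (j < N)%N -> ip G l`_i l`_j = g i.+1 j.+1) ->
  exists F : 'M[R]_n, [/\ F \in unitmx, has_brackets br F c & has_metric G F g].
Proof.
move=> nN; subst N => span brl ipl; pose F : 'M[R]_n := \matrix_(i < n) l`_i.
exists F; split.
- rewrite -row_full_unit -sub1mx; apply/row_subP => i; have [d ->] := span (row i 1%:M).
  by apply: summx_sub => j _; rewrite scalemx_sub // -[l`_j](rowK (fun i : 'I_n => l`_i)) row_sub.
- move=> i j; rewrite !rowK brl //; apply: eq_bigr => k _; by rewrite rowK.
- by move=> i j; rewrite !rowK ipl.
Qed.

(** * Explicit bases for the two families *)

Section Final.
Variables (R : realType) (n : nat) (br : 'rV[R]_n -> 'rV[R]_n -> 'rV[R]_n).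
Variable G : 'M[R]_n.
Local Notation ip := (ip G).
Hypothesis lie : is_lie_bracket br.
Hypothesis symG : G^T = G.
Variables (e : 'rV[R]_n).
Hypothesis e_central : forall x, br e x = 0.
Hypothesis ip_ee : ip e e = 1.
Variables (m : nat) (v y : 'I_m -> 'rV[R]_n) (mu : 'I_m -> R) (o a b : 'I_m) (sg : R).
Hypothesis form : standard_form br G e v y mu o a b sg.

(** This and the next two lemmas bundle equations in a product so that a single [rewrite] applies
    whichever one matches. *)
Lemma standard_form_neq : ((a == o) = false) * ((b == o) = false) * ((a == b) = false) *
  ((o == a) = false) * ((o == b) = false) * ((b == a) = false).
Proof.
case: form => [[ao bo ab _] _ _ _ _].
by rewrite !(eq_sym o) (eq_sym b a) (negPf ao) (negPf bo) (negPf ab).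
Qed.

Lemma standard_form_ip : (forall i j, ip (v i) (v j) = if i == j then 1 else 0) *
  (forall i j, ip (y i) (y j) = if i == j then mu i else 0) *
  (forall i j, ip (y i) (v j) = 0) * (forall i j, ip (v i) (y j) = 0) *
  (forall i, ip (v i) e = 0) * (forall i, ip e (v i) = 0) *
  (forall i, ip (y i) e = 0) * (forall i, ip e (y i) = 0) * (ip e e = 1).
Proof.
case: form => [_ _ [vv yy yv ve] _ _].
have ve0 i : ip (v i) e = 0 by have [] := ve i.
have ye0 i : ip (y i) e = 0 by have [] := ve i.
do !split=> //.
- by move=> i j; rewrite (ipC symG).
- by move=> i; rewrite (ipC symG).
- by move=> i; rewrite (ipC symG).
Qed.

Lemma standard_form_br : (br (v o) (v a) = - sg *: y b) * (br (v o) (v b) = sg *: y a) *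
  (br (v a) (v b) = - sg *: y o) * (br (v a) (v o) = sg *: y b) * (br (v b) (v o) = - sg *: y a) *
  (br (v b) (v a) = sg *: y o) *
  (forall i j, br (y i) (v j) = (if i == j then mu i else 0) *: e) *
  (forall i j, br (v j) (y i) = - (if i == j then mu i else 0) *: e) *
  (forall i j, br (y i) (y j) = 0) *
  (forall x, br e x = 0) * (forall x, br x e = 0) * (forall x, br x x = 0).
Proof.
case: form => [_ _ _ [b1 b2 b3 b4 b5] _].
do !split=> //.
- by rewrite brC // b1 scaleNr opprK.
- by rewrite brC // b2 scaleNr.
- by rewrite brC // b3 scaleNr opprK.
- by move=> i j; rewrite brC // b4 scaleNr.
- by move=> x; rewrite brC // e_central oppr0.
- exact: br_self.
Qed.

Lemma standard_form_span x : x = ip x e *: e + (ip x (v o) *: (v o) + (ip x (v a) *: (v a) + ip x (v b) *: (v b))) +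
  ((ip x (y o) / mu o) *: (y o) + ((ip x (y a) / mu a) *: (y a) + (ip x (y b) / mu b) *: (y b))).
Proof.
case: form => [[ao bo ab cov] _ _ _ span].
have sum3 (F : 'I_m -> 'rV[R]_n) : \sum_i F i = F o + (F a + F b).
  rewrite (bigD1 o) //= (bigD1 a) //= (bigD1 b) /= ?bo 1?eq_sym // big1 ?addr0 // => i.
  by case/andP=> /andP[io ia] ib; have := cov i; rewrite (negPf io) (negPf ia) (negPf ib).
by rewrite {1}[x]span !sum3.
Qed.

Lemma standard_form_dim7 : 0 < mu b -> n = 7%N /\ exists (F : 'M[R]_n) (r c : R),
  [/\ F \in unitmx, 0 < r < 1, 0 < c, has_brackets br F (C7 r) & has_metric G F (G7 r c)].
Proof.
move=> mb; have [_ [sgE ma _ moE] _ _ _] := form.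
pose s := mu a + mu b.
have s0 : 0 < s by rewrite addr_gt0.
have sn0 : s != 0 by rewrite gt_eqF.
have man0 : mu a != 0 by rewrite gt_eqF.
have mbn0 : mu b != 0 by rewrite gt_eqF.
have mon0 : mu o != 0 by rewrite moE oppr_eq0.
have sg2 : sg * sg = 1 by case: sgE => ->; rewrite ?mulrNN mulr1.
(* The norms [mu o = - s], [mu b = s r] and [mu a = s (1 - r)] are those of [f_4], [f_5] and [f_6]
   with metric parameter [s]; the factors [sg] in the list absorb the sign. *)
pose r := mu b / s.
pose l := [:: (v o); (v a); (v b); - sg *: (y o); - sg *: (y b); sg *: (y a); (sg * s) *: e].
have span x : exists c : nat -> R, x = \sum_(i < 7) c i *: l`_i.
  exists (nth 0 [:: ip x (v o); ip x (v a); ip x (v b); - sg * (ip x (y o) / mu o);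
    - sg * (ip x (y b) / mu b); sg * (ip x (y a) / mu a); sg * ip x e / s]).
  rewrite {1}[x]standard_form_span !big_ord_recl big_ord0 /=.
  by case: sgE => ->; apply/rowP => j; rewrite !mxE; field; rewrite sn0 man0 mbn0 mon0.
have n7 : n = 7%N.
  apply: (@orthogonal_basis_dim R n 7 G l (nth 0 [:: 1; 1; 1; mu o; mu b; mu a; s ^+ 2]) _ _ span).
    by case=> [|[|[|[|[|[|[|//]]]]]]] _ /=; rewrite ?oner_eq0 ?sqrf_eq0.
  by case=> [|[|[|[|[|[|[|//]]]]]]]; case=> [|[|[|[|[|[|[|//]]]]]]] _ _ /=;
    rewrite ?(ipZl, ipZr) ?standard_form_ip ?standard_form_neq ?eqxx; case: sgE => sgv; rewrite ?sgv; ring.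
split=> //.
have bracket i j : (i < 7)%N -> (j < 7)%N ->
    br l`_i l`_j = \sum_(k < 7) C7 r i.+1 j.+1 k.+1 *: l`_k.
  move: i j; case=> [|[|[|[|[|[|[|//]]]]]]]; case=> [|[|[|[|[|[|[|//]]]]]]] _ _;
    rewrite !big_ord_recl big_ord0 /= ?(brZl lie, brZr lie) ?standard_form_br
      ?standard_form_neq ?eqxx ?moE; apply/rowP => k; rewrite !mxE /r /s;
    (case: sgE => sgv; rewrite ?sgv; field; rewrite ?sn0 ?man0 ?mbn0 ?mon0; try done).
have metric i j : (i < 7)%N -> (j < 7)%N -> ip l`_i l`_j = G7 r s i.+1 j.+1.
  move: i j; case=> [|[|[|[|[|[|[|//]]]]]]]; case=> [|[|[|[|[|[|[|//]]]]]]] _ _ /=;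
    rewrite ?(ipZl, ipZr) ?standard_form_ip ?standard_form_neq ?eqxx ?moE /r /s;
    (case: sgE => sgv; rewrite ?sgv; field; rewrite ?sn0 ?man0 ?mbn0 ?mon0; try done).
have [F [FU FB FM]] := basis_of_list n7 span bracket metric.
exists F, r, s; split=> //.
by rewrite /r divr_gt0 // ltr_pdivrMr // mul1r /s ltrDr.
Qed.

Lemma standard_form_dim6 : mu b = 0 -> n = 6%N /\ exists (F : 'M[R]_n) (al : R),
  [/\ F \in unitmx, al != 0, has_brackets br F C6 & has_metric G F (G6 al)].
Proof.
move=> mb0; have [_ [sgE ma _ moE] _ _ fspan] := form.
rewrite mb0 addr0 in moE.
have man0 : mu a != 0 by rewrite gt_eqF.
have mon0 : mu o != 0 by rewrite moE oppr_eq0.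
(* [y b] is orthogonal to [e], to all [v i] and, as [mu b = 0], to all [y i]; its expansion is
   zero. *)
have yb0 : y b = 0.
  rewrite [y b]fspan !standard_form_ip scale0r add0r !big1 ?addr0 // => i _.
    by rewrite standard_form_ip mb0; case: eqP; rewrite mul0r scale0r.
  by rewrite standard_form_ip scale0r.
have spanx x : x = ip x e *: e + (ip x (v o) *: v o + (ip x (v a) *: v a + ip x (v b) *: v b)) +
    ((ip x (y o) / mu o) *: y o + (ip x (y a) / mu a) *: y a).
  by rewrite {1}[x]standard_form_span yb0 scaler0 addr0.
have n6 : n = 6%N.
  pose l := [:: v o; v a; v b; y o; y a; e].
  apply: (@orthogonal_basis_dim R n 6 G l (nth 0 [:: 1; 1; 1; mu o; mu a; 1])).
  - by case=> [|[|[|[|[|[|//]]]]]] _ /=; rewrite ?oner_eq0.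
  - by case=> [|[|[|[|[|[|//]]]]]]; case=> [|[|[|[|[|[|//]]]]]] _ _ /=;
      rewrite ?standard_form_ip ?standard_form_neq ?eqxx.
  - move=> x; exists (nth 0 [:: ip x (v o); ip x (v a); ip x (v b); ip x (y o) / mu o;
      ip x (y a) / mu a; ip x e]).
    rewrite {1}[x]spanx !big_ord_recl big_ord0 /=.
    by apply/rowP => j; rewrite !mxE; ring.
(* As [mu o = - mu a], the vectors [y o - y a] and [y a + y o] are null with product [- 2 * mu a];
   hence [al] is the square root of [mu a]. *)
pose l := [:: v b; v o + v a; v a - v o; sg *: (y o - y a); sg *: (y a + y o); (2 * sg * mu a) *: e].
have span x : exists c : nat -> R, x = \sum_(i < 6) c i *: l`_i.
  exists (nth 0 [:: ip x (v b); (ip x (v o) + ip x (v a)) / 2; (ip x (v a) - ip x (v o)) / 2;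
    sg * (ip x (y o) / mu o - ip x (y a) / mu a) / 2;
    sg * (ip x (y o) / mu o + ip x (y a) / mu a) / 2; sg * ip x e / (2 * mu a)]).
  rewrite {1}[x]spanx !big_ord_recl big_ord0 /=.
  by case: sgE => ->; apply/rowP => j; rewrite !mxE; field; rewrite man0 mon0.
have bracket i j : (i < 6)%N -> (j < 6)%N ->
    br l`_i l`_j = \sum_(k < 6) C6 i.+1 j.+1 k.+1 *: l`_k.
  move: i j; case=> [|[|[|[|[|[|//]]]]]]; case=> [|[|[|[|[|[|//]]]]]] _ _;
    rewrite !big_ord_recl big_ord0 /= ?(brZl lie, brZr lie, brDl lie, brDr lie, brNl lie, brNr lie)
      ?standard_form_br ?standard_form_neq ?eqxx ?moE ?yb0;
    apply/rowP => k; rewrite !mxE; (case: sgE => sgv; rewrite ?sgv; ring).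
pose al := Num.sqrt (mu a).
have al2 : al ^+ 2 = mu a by rewrite sqr_sqrtr // ltW.
have metric i j : (i < 6)%N -> (j < 6)%N -> ip l`_i l`_j = G6 al i.+1 j.+1.
  move: i j; case=> [|[|[|[|[|[|//]]]]]]; case=> [|[|[|[|[|[|//]]]]]] _ _ /=;
    rewrite ?(ipZl, ipZr, ipDl, ipDr, ipNl, ipNr) ?standard_form_ip ?standard_form_neq ?eqxx
      ?(exprM al 2 2) ?al2 ?moE;
    (case: sgE => sgv; rewrite ?sgv; ring).
have [F [FU FB FM]] := basis_of_list n6 span bracket metric.
split=> //; exists F, al; split=> //.
by rewrite sqrtr_eq0 -ltNge.
Qed.
End Final.

Theorem mainTheorem1 (R : realType) (n : nat)
  (br : 'rV[R]_n -> 'rV[R]_n -> 'rV[R]_n) (G : 'M[R]_n) :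
  is_lie_bracket br ->
  three_step_nilpotent br ->
  center_dim1 br ->
  lorentzian G ->
  nondegenerate_sub G (in_center br) ->
  (einstein br G <->
   (ricci_flat br G /\
    ((n = 6%N /\ exists (F : 'M[R]_n) (al : R),
        [/\ F \in unitmx, al != 0, has_brackets br F C6 &
            has_metric G F (G6 al)])
     \/
     (n = 7%N /\ exists (F : 'M[R]_n) (r a : R),
        [/\ F \in unitmx, 0 < r < 1, 0 < a, has_brackets br F (C7 r) &
            has_metric G F (G7 r a)])))).
Proof.
move=> lie [nilp not2step] [z0 [z00 zE]] lor nondeg.
have symG : G^T = G by case: lor.
have unitG := lorentzian_unit lor.
split; last first.
  case=> flat _; exists 0 => u; rewrite scale0r /Ric.
  have -> : \row_k ric br G u (ebase R k) = 0 by apply/rowP => k; rewrite !mxE flat.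
  by rewrite mul0mx.
case=> lam einst.
have zz : ip G z0 z0 != 0.
  apply: contraNneq z00 => h; apply/eqP/nondeg => [|w]; first by apply/zE; exists 1; rewrite scale1r.
  by move=> /zE [c ->]; rewrite ipZr h mulr0.
(* Nondegeneracy of the center makes [<z0,z0>] nonzero, so [z0] can be scaled to norm [1] or
   [-1]. *)
pose c := (Num.sqrt `|ip G z0 z0|)^-1.
have c0 : c != 0 by rewrite invr_eq0 sqrtr_eq0 -ltNge normr_gt0.
pose e := c *: z0.
have centerE w : in_center br w <-> exists d : R, w = d *: e.
  split=> [/zE [d ->]|[d ->]].
    by exists (d / c); rewrite /e scalerA divfK.
  by apply/zE; exists (d * c); rewrite scalerA.
have eps1 : ip G e e = 1 \/ ip G e e = -1.
  have -> : ip G e e = ip G z0 z0 / `|ip G z0 z0|.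
    by rewrite ipZl ipZr mulrA -invfM -expr2 sqr_sqrtr // mulrC.
  case: (ltrgt0P (ip G z0 z0)) => h; last by case/eqP: zz.
    by left; rewrite divff.
  by right; rewrite invrN mulrN divff.
have ricE := einstein_ric lie nilp symG unitG einst.
have [lam0 [m [v [y [mu [o [a [b [sg form]]]]]]]]] :=
  einstein_standard_form lie nilp not2step lor centerE (erefl _) eps1 ricE.
have e1 := center_spacelike lie nilp not2step lor centerE (erefl _) eps1 ricE.
have ec : forall x, br e x = 0 by apply/(centerE e); exists 1; rewrite scale1r.
split; first by move=> u w; rewrite ricE lam0 mul0r.
have [_ [_ _ mb _] _ _ _] := form.
(* Vanishing of [mu b] lowers the dimension by one, because [y b] disappears from the basis. *)
have [mb0|mb0] := eqVneq (mu b) 0; first by left; apply: (standard_form_dim6 lie symG ec e1 form).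
right; apply: (standard_form_dim7 lie symG ec e1 form).
by rewrite lt_def mb0 mb.
Qed.
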